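(* Fix an integer $b\ge 1$. For each of the three families below, take the indicated weight sequences $(\varphi_k)_{k\ge0}$ and $(\psi_k)_{1\le k\le b-1}$, and consider the corresponding weighted family $\mathcal{T}$ of ordered increasing bucket trees with maximal bucket size $b$ (see context). Then: (A) For every ordered increasing bucket tree $T\in\mathcal{T}$ of size $n$ and every node $v\in T$, the probability under the random tree model that the new label $n+1$ is attracted by $v$, i.e. the ratio $$p_T(v)=\frac{\sum_{T':\,T\xrightarrow{v}T'} w(T')}{\sum_{T':\,T\to T'} w(T')},$$ equals the attraction probability $p(v)$ of the corresponding growth process (recalled in the context). Consequently the law of the random (unordered) tree of size $n$ produced by the growth process coincides with the law of the random unordered bucket increasing tree of size $n$ under the random tree model, for every $n\ge1$. (B) The weights, the exponential generating function $T(z)=\sum_{n\ge1}T_n z^n/n!$ and the total weights $T_n$ are: 1. Bucket recursive trees: $\varphi_k=\frac{(b-1)!\,b^k}{k!}$ ($k\ge0$), $\psi_k=(k-1)!$ ($1\le k\le b-1$), so $\varphi(t)=(b-1)!\,e^{bt}$; then $T(z)=\log\frac{1}{1-z}$ and $T_n=(n-1)!$. 2. $(b,d)$-ary increasing trees ($d\ge2$ an integer): $\varphi_k=(b-1)!(d-1)^{b-1}\binom{b-1+\frac1{d-1}}{b-1}\binom{b(d-1)+1}{k}$ ($k\ge0$), $\psi_k=(k-1)!(d-1)^{k-1}\binom{k-1+\frac1{d-1}}{k-1}$ ($1\le k\le b-1$), so $\varphi(t)=(b-1)!(d-1)^{b-1}\binom{b-1+\frac1{d-1}}{b-1}(1+t)^{b(d-1)+1}$;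 then $T(z)=(1-(d-1)z)^{-\frac1{d-1}}-1$ and $T_n=(n-1)!(d-1)^{n-1}\binom{n-1+\frac1{d-1}}{n-1}$. 3. $(b,\alpha)$-plane oriented recursive trees ($\alpha>0$ real): $\varphi_k=(b-1)!(\alpha+1)^{b-1}\binom{b-1-\frac1{\alpha+1}}{b-1}\binom{(\alpha+1)b-2+k}{k}$ ($k\ge0$), $\psi_k=(k-1)!(\alpha+1)^{k-1}\binom{k-1-\frac1{\alpha+1}}{k-1}$ ($1\le k\le b-1$), so $\varphi(t)=\frac{(b-1)!(\alpha+1)^{b-1}\binom{b-1-\frac1{\alpha+1}}{b-1}}{(1-t)^{(\alpha+1)b-1}}$; then $T(z)=1-(1-(\alpha+1)z)^{\frac1{\alpha+1}}$ and $T_n=(n-1)!(\alpha+1)^{n-1}\binom{n-1-\frac1{\alpha+1}}{n-1}$.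
   Context: Binomial coefficients with non-integer upper argument: $\binom{x}{k}=x(x-1)\cdots(x-k+1)/k!$. Ordered bucket trees: fix $b\ge1$. An ordered bucket tree is a rooted plane tree (children of each node are linearly ordered) whose nodes (''buckets'') $v$ have a capacity $c(v)\in\{1,\dots,b\}$; $v$ is saturated if $c(v)=b$, and every node with at least one child must be saturated. Its size is $\sum_v c(v)$. An increasing labelling of a tree of size $n$ distributes the labels $1,\dots,n$ so that node $v$ receives $c(v)$ labels and every label of a node is smaller than all labels in its children. Given a sequence $(\varphi_k)_{k\ge0}$ of nonnegative numbers with $\varphi_0>0$ and nonnegative $\psi_1,\dots,\psi_{b-1}$, the weight of a tree is $w(T)=\prod_v w(v)$ with $w(v)=\varphi_{d^+(v)}$ if $c(v)=b$ and $w(v)=\psi_{c(v)}$ if $c(v)<b$, where $d^+(v)$ is the number of children of $v$; $\varphi(t)=\sum_k\varphi_k t^k$. $\mathcal{T}$ is the set of increasingly labelled ordered bucket trees with these weights; $T_n$ is the total weight of those of size $n$. Random tree model: a tree of size $n$ is chosen with probability $w(T)/T_n$; an unordered increasingly labelled bucket tree $U$ gets probability $w\cdot\prod_{v}d^+(v)!/T_n$ (the weight of any of its $\prod_v d^+(v)!$ ordered versions, times their number, over $T_n$). For $T$ of size $n$, $T\to T'$ means $T'$ arises from $T$ by inserting label $n+1$: either adding it to an unsaturated node, or attaching to a saturated node $u$ a new bucket containing only $n+1$ at one of the $d^+(u)+1$ possible positions among its children; $T\xrightarrow{v}T'$ means this is done at node $v$. Growth processes (unordered trees): start with a root bucket containing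 label 1; given the tree of size $n\ge1$, a node $v$ is chosen with probability $p(v)$; if $v$ is unsaturated, label $n+1$ is added to $v$, otherwise a new child bucket of $v$ containing only $n+1$ is created. Here, with capacities and out-degrees taken in the current tree of size $n$: bucket recursive trees $p(v)=c(v)/n$; $(b,d)$-ary increasing trees ($d\ge2$ integer) $p(v)=\frac{(d-1)c(v)+1-d^+(v)}{(d-1)n+1}$; $(b,\alpha)$-plane oriented recursive trees ($\alpha>0$) $p(v)=\frac{d^+(v)+(\alpha+1)c(v)-1}{(\alpha+1)n-1}$. *)

(* Defs.v *)
From Stdlib Require List.
From HB Require Import structures.
From mathcomp Require Import all_boot all_order all_algebra.
From mathcomp Require Import all_classical all_reals all_analysis.

Set Implicit Arguments.
Unset Strict Implicit.
Unset Printing Implicit Defensive.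
Import Order.TTheory GRing.Theory Num.Theory.
Local Open Scope ring_scope.

Definition gbinom (R : realType) (x : R) (k : nat) : R :=
  (\prod_(i < k) (x - i%:R)) / (k`!)%:R.

(** * Ordered increasingly labelled bucket trees.
    A node ("bucket") is [BNode ls cs]: [ls] is the (increasingly sorted)
    list of labels of the bucket, so its capacity is [size ls];
    [cs] is the ordered list of its children. *)
Inductive btree := BNode of seq nat & seq btree.

Definition labels (t : btree) : seq nat := let: BNode ls _ := t in ls.
Definition children (t : btree) : seq btree := let: BNode _ cs := t in cs.

(* countType structure (needed to sum over sets of trees) *)
Fixpoint btree_enc (t : btree) : GenTree.tree (seq nat) :=
  let: BNode ls cs := t in GenTree.Node 0 (GenTree.Leaf ls :: map btree_enc cs).
Fixpoint btree_dec (g : GenTree.tree (seq nat)) : btree :=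
  match g with
  | GenTree.Node _ (GenTree.Leaf ls :: l) => BNode ls (map btree_dec l)
  | _ => BNode [::] [::]
  end.
Lemma btree_encK_aux : forall t, btree_dec (btree_enc t) = t.
Proof.
fix IH 1; case=> ls cs /=; congr BNode.
elim: cs => [|c cs IHcs] //=; by rewrite IH IHcs.
Qed.
Lemma btree_encK : cancel btree_enc btree_dec.
Proof. exact: btree_encK_aux. Qed.
HB.instance Definition _ := Countable.copy btree (can_type btree_encK).

Fixpoint all_labels (t : btree) : seq nat :=
  let: BNode ls cs := t in ls ++ flatten (map all_labels cs).

Definition tsize (t : btree) : nat := size (all_labels t).

Fixpoint wf_bucket (b : nat) (t : btree) : bool :=
  let: BNode ls cs := t in
  [&& (0 < size ls)%N, (size ls <= b)%N,
      (cs != [::]) ==> (size ls == b),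
      sorted ltn ls,
      all (fun c => all (fun y => all (fun x => (x < y)%N) ls) (labels c)) cs
    & all (wf_bucket b) cs].

Definition ibt (b n : nat) (t : btree) : bool :=
  wf_bucket b t && perm_eq (all_labels t) (iota 1 n).

Section Weight.
Variables (R : realType) (b : nat) (phi psi : nat -> R).
Fixpoint weight (t : btree) : R :=
  let: BNode ls cs := t in
  (if size ls == b then phi (size cs) else psi (size ls))
    * \prod_(x <- map weight cs) x.
End Weight.

Fixpoint degfact (t : btree) : nat :=
  let: BNode _ cs := t in (size cs)`! * \prod_(x <- map degfact cs) x.

(** Nodes are addressed by paths (sequences of child indices) from the root. *)
Fixpoint subtree (t : btree) (p : seq nat) : option btree :=
  match p with
  | [::] => Some t
  | i :: p' => if (i < size (children t))%N
               then subtree (nth t (children t) i) p' else None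
  end.

Definition is_node (t : btree) (p : seq nat) : bool := subtree t p != None.

Fixpoint modify (f : btree -> btree) (t : btree) (p : seq nat) : btree :=
  match p with
  | [::] => f t
  | i :: p' => let: BNode ls cs := t in
               BNode ls (set_nth t cs i (modify f (nth t cs i) p'))
  end.

Definition add_label (x : nat) (u : btree) : btree :=
  let: BNode ls cs := u in BNode (rcons ls x) cs.

Definition add_child (x i : nat) (u : btree) : btree :=
  let: BNode ls cs := u in BNode ls (take i cs ++ BNode [:: x] [::] :: drop i cs).

Definition insert_at (b : nat) (t : btree) (v : seq nat) (t' : btree) : Prop :=
  exists2 u, subtree t v = Some u &
    if (size (labels u) < b)%N then t' = modify (add_label (tsize t).+1) t v
    else exists2 i, (i <= size (children u))%N &
                    t' = modify (add_child (tsize t).+1 i) t v.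

Inductive bfamily (R : Type) :=
  | BRT
  | BDary of nat
  | BPORT of R.
Arguments BRT {R}.

Section Families.
Variables (R : realType) (b : nat).

Definition fam_ok (fam : bfamily R) : Prop :=
  match fam with
  | BRT => True
  | BDary d => (2 <= d)%N
  | BPORT a => 0 < a
  end.

Definition phiw (fam : bfamily R) (k : nat) : R :=
  match fam with
  | BRT => ((b.-1)`!)%:R * (b%:R) ^+ k / (k`!)%:R
  | BDary d => ((b.-1)`!)%:R * ((d.-1)%:R) ^+ b.-1
               * gbinom ((b.-1)%:R + ((d.-1)%:R)^-1) b.-1
               * ('C(b * d.-1 + 1, k))%:R
  | BPORT a => ((b.-1)`!)%:R * (a + 1) ^+ b.-1
               * gbinom ((b.-1)%:R - (a + 1)^-1) b.-1
               * gbinom ((a + 1) * b%:R - 2 + k%:R) k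
  end.

Definition psiw (fam : bfamily R) (k : nat) : R :=
  match fam with
  | BRT => ((k.-1)`!)%:R
  | BDary d => ((k.-1)`!)%:R * ((d.-1)%:R) ^+ k.-1
               * gbinom ((k.-1)%:R + ((d.-1)%:R)^-1) k.-1
  | BPORT a => ((k.-1)`!)%:R * (a + 1) ^+ k.-1
               * gbinom ((k.-1)%:R - (a + 1)^-1) k.-1
  end.

Definition phi_gf (fam : bfamily R) (t : R) : R :=
  match fam with
  | BRT => ((b.-1)`!)%:R * expR (b%:R * t)
  | BDary d => ((b.-1)`!)%:R * ((d.-1)%:R) ^+ b.-1
               * gbinom ((b.-1)%:R + ((d.-1)%:R)^-1) b.-1
               * (1 + t) ^+ (b * d.-1 + 1)
  | BPORT a => ((b.-1)`!)%:R * (a + 1) ^+ b.-1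
               * gbinom ((b.-1)%:R - (a + 1)^-1) b.-1
               / (1 - t) `^ ((a + 1) * b%:R - 1)
  end.

Definition phi_dom (fam : bfamily R) (t : R) : Prop :=
  match fam with
  | BRT => True
  | BDary _ => True
  | BPORT _ => `|t| < 1
  end.

Definition fweight (fam : bfamily R) (t : btree) : R :=
  weight b (phiw fam) (psiw fam) t.

Definition Ttot (fam : bfamily R) (n : nat) : R :=
  \sum_(t \in [set t | ibt b n t]%classic) fweight fam t.

Definition pT (fam : bfamily R) (t : btree) (v : seq nat) : R :=
  (\sum_(t' \in [set t' | insert_at b t v t']%classic) fweight fam t')
  / (\sum_(t' \in [set t' | exists v', insert_at b t v' t']%classic)
        fweight fam t').

Definition pgrowth (fam : bfamily R) (t : btree) (v : seq nat) : R :=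
  let n := tsize t in
  let (c, dp) := match subtree t v with
                 | Some u => (size (labels u), size (children u))
                 | None => (0%N, 0%N) end in
  match fam with
  | BRT => c%:R / n%:R
  | BDary d => ((d.-1)%:R * c%:R + 1 - dp%:R) / ((d.-1)%:R * n%:R + 1)
  | BPORT a => (dp%:R + (a + 1) * c%:R - 1) / ((a + 1) * n%:R - 1)
  end.

Definition Tn_formula (fam : bfamily R) (n : nat) : R :=
  match fam with
  | BRT => ((n.-1)`!)%:R
  | BDary d => ((n.-1)`!)%:R * ((d.-1)%:R) ^+ n.-1
               * gbinom ((n.-1)%:R + ((d.-1)%:R)^-1) n.-1
  | BPORT a => ((n.-1)`!)%:R * (a + 1) ^+ n.-1
               * gbinom ((n.-1)%:R - (a + 1)^-1) n.-1
  end.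

Definition T_gf (fam : bfamily R) (z : R) : R :=
  match fam with
  | BRT => ln ((1 - z)^-1)
  | BDary d => (1 - (d.-1)%:R * z) `^ (- ((d.-1)%:R)^-1) - 1
  | BPORT a => 1 - (1 - (a + 1) * z) `^ ((a + 1)^-1)
  end.

(* disc of convergence of the EGF T(z) *)
Definition T_dom (fam : bfamily R) (z : R) : Prop :=
  match fam with
  | BRT => `|z| < 1
  | BDary d => `|z| < ((d.-1)%:R)^-1
  | BPORT a => `|z| < (a + 1)^-1
  end.

(** Growth process (unordered trees, represented by ordered representatives:
    a new child bucket is appended as last child). *)
Definition gstep (t : btree) (v : seq nat) : option btree :=
  match subtree t v with
  | None => None
  | Some u => Some (if (size (labels u) < b)%N
                    then modify (add_label (tsize t).+1) t v
                    else modify (add_child (tsize t).+1 (size (children u))) t v)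
  end.

Fixpoint grow (vs : seq (seq nat)) (t : btree) : option btree :=
  match vs with
  | [::] => Some t
  | v :: vs' => match gstep t v with None => None | Some t' => grow vs' t' end
  end.

Fixpoint gprob (fam : bfamily R) (vs : seq (seq nat)) (t : btree) : R :=
  match vs with
  | [::] => 1
  | v :: vs' => match gstep t v with
                | None => 0
                | Some t' => pgrowth fam t v * gprob fam vs' t'
                end
  end.

End Families.

Definition root1 : btree := BNode [:: 1%N] [::].

(** Equality of the underlying unordered trees: same buckets, children
    equal up to reordering, recursively. *)
Inductive tequiv : btree -> btree -> Prop :=
  | TEquiv ls cs1 cs cs2 :
      perm_eq cs cs2 -> List.Forall2 tequiv cs1 cs ->
      tequiv (BNode ls cs1) (BNode ls cs2).

Definition growth_law (R : realType) (b : nat) (fam : bfamily R) (t : btree) : R :=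
  \sum_(vs \in [set vs | exists2 t', grow b vs root1 = Some t' & tequiv t' t]%classic)
     gprob b fam vs root1.

Definition model_law (R : realType) (b : nat) (fam : bfamily R) (t : btree) : R :=
  fweight b fam t * (degfact t)%:R / Ttot b fam (tsize t).

(* Main.v *)
(** In all three families the weights satisfy one recurrence: with [slope] and
    [offset] as below and [attraction c d = slope * c + offset * (1 - d)],
    the factor of an unsaturated bucket of capacity [c] is multiplied by
    [attraction c 0] when a label is added, and
    [(d + 1) * phi_(d+1) = attraction b d * phi_d].  So the [d + 1] insertions
    at a saturated node have total weight [attraction b d * w(T)], and likewise
    at an unsaturated one.  Summed over the nodes, the attractions telescope to
    [slope * n + offset], since a tree has one edge less than nodes; this gives
    the attraction probabilities and [T_(n+1) = (slope * n + offset) * T_n].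
    For the laws: each unordered tree has exactly one representative whose
    siblings are sorted by first label, the growth process only produces such
    representatives, each along a single history, and the probability of that
    history is [w(T) * prod_v d(v)! / T_n] by the same recurrence.
    The generating functions reduce to the binomial and logarithmic series:
    [(1 - u)^s] times the [N]-th partial sum has derivative
    [- N * c_N * u^(N-1) * (1 - u)^(s-1)], and the mean value theorem applies. *)
Require Import Defs.
From HB Require Import structures.
From mathcomp Require Import all_boot all_order all_algebra.
From mathcomp Require Import all_classical all_reals all_analysis.
From mathcomp Require Import zify ring lra.
Local Open Scope nat_scope.
Set Implicit Arguments.
Unset Strict Implicit.
Unset Printing Implicit Defensive.

(* Both names are shadowed by MathComp ([tuple.tsize], [poly.root1]). *)
Local Notation tsize := Defs.tsize.
Local Notation root1 := Defs.root1.

(** * Insertion and deletion of the largest label *)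

(** The principle generated for [btree] has no induction hypothesis for the trees inside the list of
    children. *)
Lemma btree_nested_ind (P : btree -> Prop) :
  (forall ls cs, (forall c, c \in cs -> P c) -> P (BNode ls cs)) ->
  forall t, P t.
Proof.
move=> H; fix IH 1; case=> ls cs; apply: H.
elim: cs => [d|c cs IHcs d]; first by rewrite in_nil; discriminate.
rewrite inE => /orP[/eqP->|]; first exact: IH.
exact: IHcs.
Qed.

(* [t'] is [t] with its subtree [u] at address [v] replaced by [u']. *)
Inductive replaced : btree -> seq nat -> btree -> btree -> btree -> Prop :=
  | ReplacedRoot u u' : replaced u [::] u u' u'
  | ReplacedBelow ls cs1 c cs2 p u u' c' : replaced c p u u' c' ->
      replaced (BNode ls (cs1 ++ c :: cs2)) (size cs1 :: p) u u'
               (BNode ls (cs1 ++ c' :: cs2)).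

(** Together with [replacedP] this trades the index-based [modify] for a relation whose induction
    splits the list of children around the path. *)
Lemma replaced_modify f t v u :
  subtree t v = Some u -> replaced t v u (f u) (modify f t v).
Proof.
elim: v t => [|i v IH] [ls cs] /=; first by case=> ->; constructor.
case: ltnP => // lt_i /IH; set c := nth _ _ _ => Hc.
have szi : size (take i cs) = i by rewrite size_takel // ltnW.
have Ecs : cs = take i cs ++ c :: drop i.+1 cs.
  by rewrite -drop_nth // cat_take_drop.
have := ReplacedBelow ls (take i cs) (drop i.+1 cs) Hc.
by rewrite szi -Ecs set_nthE lt_i.
Qed.

Lemma replacedP f t v u t' :
  replaced t v u (f u) t' -> subtree t v = Some u /\ t' = modify f t v.
Proof.
suff: forall u', replaced t v u u' t' -> u' = f u ->
    subtree t v = Some u /\ t' = modify f t v by move=> /[apply]; exact.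
move=> u'; elim=> {t v u u' t'} [u u' -> //|ls cs1 c cs2 p u u' c' Hc IH E].
have [Esub ->] := IH E.
rewrite /= size_cat /= addnS ltnS leq_addr nth_cat ltnn subnn /=; split => //.
congr BNode; rewrite set_nthE size_cat /= addnS ltnS leq_addr.
by rewrite take_size_cat // -(cat_rcons c) drop_size_cat ?size_rcons.
Qed.

(** The local effect of an insertion at the chosen node, separated from the address of that node.
    The function [append_label] below is its deterministic instance, the one used by the growth
    process. *)
Definition inserted (b x : nat) (u u' : btree) : Prop :=
  if (size (labels u) < b)%N then u' = add_label x u
  else exists2 i, (i <= size (children u))%N & u' = add_child x i u.

Definition append_label (b x : nat) (u : btree) : btree :=
  if (size (labels u) < b)%N then add_label x u
  else add_child x (size (children u)) u.

Lemma gstepE b t v :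
  gstep b t v =
  omap (fun=> modify (append_label b (tsize t).+1) t v) (subtree t v).
Proof.
rewrite /gstep; case E: (subtree t v) => [u|] //=; congr Some.
(* Only the value of the modifying function at [u] matters, so the test on the capacity can be moved
   inside it. *)
have: forall f g : btree -> btree, f u = g u -> modify f t v = modify g t v.
  move=> f g; elim: v t E => [|i v IH] [ls cs] /=; first by case=> ->.
  by case: ifP => // _ /IH{}IH /IH ->.
by move=> H; case: ifP => Hu; apply: H; rewrite /append_label Hu.
Qed.

Lemma insert_atP b t v t' :
  insert_at b t v t' <-> exists u u',
    replaced t v u u' t' /\ inserted b (tsize t).+1 u u'.
Proof.
split=> [[u Eu]|[u [u' [Hr]]]]; rewrite /inserted.
  case: ifP => Hu [] => [->|i Hi ->].
    exists u, (add_label (tsize t).+1 u); rewrite Hu; split=> //.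
    exact: replaced_modify.
  exists u, (add_child (tsize t).+1 i u); rewrite Hu; split; last by exists i.
  exact: replaced_modify.
case: ifP => Hu.
  move=> Eu'; rewrite Eu' in Hr.
  have [Et ->] := replacedP (f := add_label _) Hr.
  by exists u; rewrite ?Hu.
move=> [i Hi Eu']; rewrite Eu' in Hr.
have [Et ->] := replacedP (f := add_child _ _) Hr.
by exists u; rewrite ?Hu //; exists i.
Qed.

Lemma wf_bucketE b ls cs : wf_bucket b (BNode ls cs) =
  [&& 0 < size ls, size ls <= b, (cs != [::]) ==> (size ls == b),
      sorted ltn ls,
      all (fun c => all (fun y => all (fun x => x < y) ls) (labels c)) cs
    & all (wf_bucket b) cs].
Proof. by []. Qed.

Lemma wf_labels_neq0 b t : wf_bucket b t -> labels t != [::].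
Proof. by case: t => [[]]. Qed.

Lemma labels_sub t : {subset labels t <= all_labels t}.
Proof. by case: t => ls cs y /=; rewrite mem_cat => ->. Qed.

Lemma all_labels_cat ls cs1 c cs2 :
  perm_eq (all_labels (BNode ls (cs1 ++ c :: cs2)))
          (all_labels c ++ all_labels (BNode ls (cs1 ++ cs2))).
Proof.
by apply/permP => q; rewrite /= !map_cat !flatten_cat /= !count_cat; lia.
Qed.

Lemma replaced_wf b t v u u' t' :
  replaced t v u u' t' -> wf_bucket b t -> wf_bucket b u.
Proof.
elim=> {t v u u' t'} // ls cs1 c cs2 p u u' c' _ IH.
by rewrite wf_bucketE !all_cat /= => /and5P[_ _ _ _ /and4P[_ _ /IH]].
Qed.

Lemma replaced_sub t v u u' t' :
  replaced t v u u' t' -> {subset all_labels u <= all_labels t}.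
Proof.
elim=> {t v u u' t'} [? ? y //|ls cs1 c cs2 p u u' c' _ IH y /IH Hy].
by rewrite (perm_mem (all_labels_cat _ _ _ _)) mem_cat Hy.
Qed.

Section Insertion.
Variables (b x : nat).

(** The order condition between a parent and a child reads only the labels of the child's bucket, so
    this dichotomy is all the inductions need about a modified child. *)
Lemma labels_inserted t v u u' t' : replaced t v u u' t' -> inserted b x u u' ->
  labels t' = labels t \/ labels t' = rcons (labels t) x.
Proof.
case=> {t v u u' t'}; last by move=> *; left.
rewrite /inserted => -[ls cs] u' /=; case: ifP => _; first by move->; right.
by move=> [i _ ->]; left.
Qed.

Lemma perm_inserted t v u u' t' : replaced t v u u' t' -> inserted b x u u' ->
  perm_eq (all_labels t') (x :: all_labels t).
Proof.
elim=> {t v u u' t'} [[ls cs] u'|ls cs1 c cs2 p u u' c' _ IH /IH Hc].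
  rewrite /inserted; case: ifP => _ => [->|[i _ ->]] /=.
    by apply/permP => q; rewrite -cats1 /= !count_cat /=; lia.
  rewrite -[in X in perm_eq _ X](cat_take_drop i cs) !map_cat !flatten_cat /=.
  by apply/permP => q; rewrite /= !count_cat /=; lia.
rewrite (perm_trans (all_labels_cat _ _ _ _)) //.
rewrite (perm_trans (perm_cat Hc (perm_refl _))) //= perm_cons perm_sym.
exact: all_labels_cat.
Qed.

Lemma wf_inserted t v u u' t' : replaced t v u u' t' -> inserted b x u u' ->
  0 < b -> wf_bucket b t -> all (fun y => y < x) (all_labels t) ->
  wf_bucket b t'.
Proof.
move=> Hr Hi b0; elim: Hr Hi => {t v u u' t'}
    [[ls cs] u'|ls cs1 c cs2 p u u' c' Hc IH Hi].
  rewrite /inserted; case: ifP => /= Hls.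
    move=> -> /and5P[s0 sb Hcs Hs /andP[_ Hw]].
    have -> : cs = [::] by case: (cs) Hcs => //= ? ? /eqP E; rewrite E ltnn in Hls.
    rewrite cats0 => Hx /=; rewrite !andbT size_rcons Hls /=.
    case: (ls) Hs Hx => // a l Hs /allP Hx.
    by rewrite /= rcons_path /= Hx ?mem_last // andbT.
  move=> [i _ ->] /and5P[s0 sb Hcs Hs /andP[Hl Hw]] Hx.
  have Eb : size ls == b by rewrite eqn_leq sb leqNgt Hls.
  rewrite wf_bucketE s0 sb Eb implybT Hs /= !all_cat /= b0 andbT /=.
  move: Hl Hw; rewrite -{1 2}(cat_take_drop i cs) !all_cat => /andP[-> ->] /andP[-> ->].
  by move: Hx; rewrite all_cat => /andP[->].
rewrite !wf_bucketE !all_cat /=.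
move=> /and5P[-> -> /implyP Eb -> /andP[/and3P[-> Hc1 ->] /and3P[-> Wc ->]]].
rewrite !map_cat !flatten_cat /= !all_cat => /and4P[Hls _ Hxc _].
rewrite (IH Hi Wc Hxc) Eb ?implybT; last by case: (cs1).
rewrite /= !andbT; case: (labels_inserted Hc Hi) => -> //.
by rewrite all_rcons Hc1 andbT.
Qed.
End Insertion.

(* A bucket [:: x] is emptied by the deletion of [x] and then dropped. *)
Fixpoint delete (x : nat) (t : btree) : btree :=
  let: BNode ls cs := t in
  BNode (rem x ls) [seq c <- map (delete x) cs | labels c != [::]].

(** The node that attracted [x]. If [x] is alone in a non-root bucket, that bucket was created by
    the insertion and the answer is its parent. Using [nth] on the mapped list keeps the recursion
    structural. *)
Fixpoint locate (x : nat) (t : btree) : seq nat :=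
  let: BNode ls cs := t in
  if (x \in ls) || has (fun c => labels c == [:: x]) cs then [::]
  else let i := find (fun c => x \in all_labels c) cs in
       i :: nth [::] (map (locate x) cs) i.

Lemma notin_all_labels_child x ls cs c :
  x \notin all_labels (BNode ls cs) -> c \in cs -> x \notin all_labels c.
Proof.
move=> /= Hx Hc; apply: contra Hx => Hx; rewrite mem_cat; apply/orP; right.
by apply/flattenP; exists (all_labels c) => //; apply: map_f.
Qed.

Lemma delete_notin b x t :
  wf_bucket b t -> x \notin all_labels t -> delete x t = t.
Proof.
elim/btree_nested_ind: t => ls cs IH.
rewrite wf_bucketE => /and5P[_ _ _ _ /andP[_ /allP Hw]] Hx /=.
have -> : map (delete x) cs = cs.
  rewrite -[RHS]map_id; apply/eq_in_map => c Hc.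
  by rewrite IH ?Hw //; apply: notin_all_labels_child Hx Hc.
have /all_filterP -> : all (fun c => labels c != [::]) cs.
  by apply/allP => c /Hw/wf_labels_neq0.
rewrite rem_id //; apply: contra Hx => /=; by rewrite mem_cat => ->.
Qed.

Section Inverse.
Variables (b x : nat).

Lemma delete_seq_notin cs : all (wf_bucket b) cs ->
  (forall c, c \in cs -> x \notin all_labels c) ->
  [seq c <- map (delete x) cs | labels c != [::]] = cs.
Proof.
move=> /allP Hw Hx; have -> : map (delete x) cs = cs.
  rewrite -[RHS]map_id; apply/eq_in_map => c Hc.
  by apply: (@delete_notin b); rewrite ?Hw ?Hx.
by apply/all_filterP/allP => c /Hw/wf_labels_neq0.
Qed.

(** With [locate_inserted], this makes an insertion reversible: the new tree determines the old tree
    and the node. Both the duplicate-free enumeration and the uniqueness of histories rest on it. *)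
Lemma delete_inserted t v u u' t' : replaced t v u u' t' -> inserted b x u u' ->
  wf_bucket b t -> x \notin all_labels t -> delete x t' = t.
Proof.
elim=> {t v u u' t'} [[ls cs] u'|ls cs1 c cs2 p u u' c' Hc IH] Hi.
  rewrite wf_bucketE => /and5P[_ _ _ _ /andP[_ Hw]] Hx.
  have Hcs c : c \in cs -> x \notin all_labels c by exact: notin_all_labels_child Hx.
  have Hls : x \notin ls by apply: contra Hx => /=; rewrite mem_cat => ->.
  move: Hi; rewrite /inserted; case: ifP => _ => [->|[i _ ->]] /=.
    rewrite delete_seq_notin //; congr BNode.
    elim: (ls) Hls => [|a l IHl] /=; first by rewrite eqxx.
    by rewrite inE negb_or => /andP[/negPf xa /IHl ->]; rewrite eq_sym xa.
  rewrite (rem_id Hls) map_cat filter_cat /= eqxx /=.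
  rewrite -{1}(cat_take_drop i cs) all_cat in Hw.
  case/andP: Hw => Hw1 Hw2.
  rewrite !delete_seq_notin ?cat_take_drop // => c Hc; apply: Hcs.
    exact: mem_drop Hc.
  exact: mem_take Hc.
rewrite wf_bucketE => /and5P[_ _ _ _ /andP[_]]; rewrite all_cat /= => /and3P[Hw1 Wc Hw2] Hx.
have Hcs d : d \in cs1 ++ c :: cs2 -> x \notin all_labels d.
  exact: notin_all_labels_child Hx.
rewrite map_cat filter_cat /= IH ?Hcs ?mem_cat ?mem_head ?orbT //.
rewrite (wf_labels_neq0 Wc) !delete_seq_notin ?rem_id //.
- by apply: contra Hx => /=; rewrite mem_cat => ->.
- by move=> d Hd; apply: Hcs; rewrite mem_cat inE Hd !orbT.
- by move=> d Hd; apply: Hcs; rewrite mem_cat Hd.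
Qed.

Lemma locate_inserted t v u u' t' : replaced t v u u' t' -> inserted b x u u' ->
  wf_bucket b t -> x \notin all_labels t -> locate x t' = v.
Proof.
elim=> {t v u u' t'} [[ls cs] u'|ls cs1 c cs2 p u u' c' Hc IH] Hi.
  move=> _ Hx; move: Hi; rewrite /inserted; case: ifP => _ => [->|[i _ ->]] /=.
    by rewrite mem_rcons mem_head.
  by rewrite has_cat /= eqxx !orbT.
rewrite wf_bucketE => /and5P[_ _ _ _ /andP[_]]; rewrite all_cat /= => /and3P[Hw1 Wc Hw2] Hx.
have Hcs d : d \in cs1 ++ c :: cs2 -> x \notin all_labels d.
  exact: notin_all_labels_child Hx.
have Hls : x \notin ls by apply: contra Hx => /=; rewrite mem_cat => ->.
have x1 : ~~ has (fun c => x \in all_labels c) cs1.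
  by apply/hasPn => d Hd; apply: Hcs; rewrite mem_cat Hd.
have Hno cs : ~~ has (fun c => x \in all_labels c) cs ->
    has (fun c => labels c == [:: x]) cs = false.
  move=> /hasPn H; apply/hasPn => d /H; apply: contra => /eqP E.
  by apply: labels_sub; rewrite E mem_head.
have xc : x \in all_labels c' by rewrite (perm_mem (perm_inserted Hc Hi)) mem_head.
have xc0 : x \notin all_labels c by apply: Hcs; rewrite mem_cat mem_head orbT.
(* Otherwise the bucket of [c] was already [[:: x]], against freshness, or was empty, against
   well-formedness. *)
have El : (labels c' == [:: x]) = false.
  apply/eqP; case: (labels_inserted Hc Hi) => -> E.
    by case/negP: xc0; apply: labels_sub; rewrite E mem_head.
  by move: (wf_labels_neq0 Wc) E; case: (labels c) => //= a [|? ?].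
rewrite (negPf Hls) /= !has_cat /= El !Hno //=; last first.
  by apply/hasPn => d Hd; apply: Hcs; rewrite mem_cat inE Hd !orbT.
rewrite find_cat (negPf x1) /= xc addn0 map_cat nth_cat size_map ltnn subnn /=.
by rewrite IH.
Qed.
End Inverse.

(** * Canonical ordered representatives *)

Definition first_label (t : btree) : nat := head 0 (labels t).

Fixpoint canonical (t : btree) : bool :=
  let: BNode _ cs := t in sorted ltn (map first_label cs) && all canonical cs.

Arguments canonical : simpl never.

Fixpoint canonize (t : btree) : btree :=
  let: BNode ls cs := t in BNode ls (sort (relpre first_label leq) (map canonize cs)).

Lemma first_label_in b t : wf_bucket b t -> first_label t \in labels t.
Proof. by case: t => [[|a l] cs] //= _; rewrite mem_head. Qed.

Lemma canonicalE ls cs : canonical (BNode ls cs) =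
  sorted ltn (map first_label cs) && all canonical cs.
Proof. by []. Qed.

Lemma rcons_max_sorted x ls : sorted ltn ls -> all (fun y => y <= x) ls ->
  x \in ls -> exists ls0, ls = rcons ls0 x.
Proof.
case/lastP: ls => // ls y Hs; rewrite all_rcons => /andP[yx _].
rewrite mem_rcons inE => /orP[/eqP->|Hx]; first by exists ls.
move: Hs; rewrite (sorted_pairwise ltn_trans) -cats1 pairwise_cat allrel1r.
by case/andP => /allP/(_ _ Hx); rewrite /= ltnNge yx.
Qed.

(** The labels of a child would exceed [x], which is already the maximum. *)
Lemma max_no_children b x ls cs : wf_bucket b (BNode ls cs) ->
  all (fun y => y <= x) (all_labels (BNode ls cs)) -> x \in ls -> cs = [::].
Proof.
rewrite wf_bucketE => /and5P[_ _ _ _ /andP[/allP Hl /allP Hw]] /allP Hx xls.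
case: cs Hl Hw Hx => // c cs /(_ c (mem_head _ _)) Hl /(_ c (mem_head _ _)) Wc Hx.
have Hf := first_label_in Wc.
have := allP (allP Hl _ Hf) _ xls; rewrite ltnNge Hx //=.
by rewrite mem_cat [X in _ || X]mem_cat (labels_sub Hf) orbT.
Qed.

Lemma replaced_first_label b x t v u u' t' : replaced t v u u' t' ->
  inserted b x u u' -> wf_bucket b t -> first_label t' = first_label t.
Proof.
move=> Hr Hi /wf_labels_neq0; rewrite /first_label.
by case: (labels_inserted Hr Hi) => -> //; case: (labels t).
Qed.

(** Undoes the insertion of the largest label [x]: it is the last label of a leaf bucket, which is
    shortened, or removed when [x] is alone in it. The hypothesis on [labels t'] keeps the root from
    being emptied. The canonical part says that the insertion undone is the one made by the growth
    process. *)
Lemma ex_inserted b x t' :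
  wf_bucket b t' -> uniq (all_labels t') ->
  all (fun y => y <= x) (all_labels t') -> x \in all_labels t' ->
  labels t' != [:: x] ->
  exists t v u u', [/\ replaced t v u u' t', inserted b x u u', wf_bucket b t &
    canonical t' -> canonical t /\ u' = append_label b x u].
Proof.
elim/btree_nested_ind: t' => ls cs IH Hw Hu Hx.
have [xls _ Hls|xls] := boolP (x \in ls).
  have Ecs := max_no_children Hw Hx xls; subst cs.
  move: Hw; rewrite wf_bucketE => /and5P[s0 sb _ Hs _].
  move: Hx; rewrite /= cats0 => Hx.
  have [ls0 E] := rcons_max_sorted Hs Hx xls; subst ls.
  rewrite size_rcons in sb.
  exists (BNode ls0 [::]), [::], (BNode ls0 [::]), (BNode (rcons ls0 x) [::]).
  split; first by constructor.
  - by rewrite /inserted /= sb.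
  - rewrite wf_bucketE /= (ltnW sb) /= andbT.
    case: (ls0) Hls Hs => [|a l _]; first by rewrite eqxx.
    by rewrite /= rcons_path => /andP[->].
  - by rewrite /append_label /= sb.
rewrite /= mem_cat (negPf xls) /= => /flattenP[_ /mapP[c Hc ->] xc] _.
move: IH Hw Hu Hx; case/splitPr: Hc => cs1 cs2 IH Hw Hu Hx.
have Hxc : all (fun y => y <= x) (all_labels c).
  by move: Hx; rewrite /= map_cat flatten_cat /= !all_cat => /and4P[].
move: (Hw); rewrite wf_bucketE => /and5P[s0 sb /implyP Hcs Hs].
rewrite !all_cat /= => /andP[/and3P[Hl1 Hlc Hl2] /and3P[Hw1 Wc Hw2]].
have {}Hcs : size ls == b by apply: Hcs; case: (cs1).
have [El|El] := eqVneq (labels c) [:: x].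
  have Ec : c = BNode [:: x] [::].
    case: (c) El Wc Hxc => l d /= -> Wc Hxc; congr BNode.
    exact: max_no_children Wc Hxc (mem_head _ _).
  subst c; exists (BNode ls (cs1 ++ cs2)), [::], (BNode ls (cs1 ++ cs2)).
  exists (BNode ls (cs1 ++ BNode [:: x] [::] :: cs2)); split; first by constructor.
  - rewrite /inserted /= (eqP Hcs) ltnn; exists (size cs1).
      by rewrite size_cat leq_addr.
    by rewrite take_size_cat // drop_size_cat.
  - by rewrite wf_bucketE s0 sb Hcs implybT Hs !all_cat Hl1 Hl2 Hw1.
  - rewrite canonicalE map_cat all_cat => /andP[Hsort /andP[Hk1 /andP[_ Hk2]]].
    (* A later sibling would have a first label above [x] by canonicity, but [x] is the maximum. *)
    have E2 : cs2 = [::].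
      case: cs2 Hsort Hx Hw2 {IH Hw Hu Hl2 Hk2} => // d cs2 /=.
      rewrite sorted_cat_cons => /andP[_ /=]; rewrite {1}/first_label /=.
      case/andP => xd _ Hx /andP[/first_label_in/labels_sub Hd _].
      move: Hx; rewrite map_cat flatten_cat /= !all_cat.
      rewrite /= all_cat => /and5P[_ _ _ /allP/(_ _ Hd)].
      by rewrite leqNgt xd.
    subst cs2; rewrite cats0 canonicalE Hk1 andbT; split.
      by apply: subseq_sorted Hsort; [exact: ltn_trans|exact: prefix_subseq].
    by rewrite /append_label /= (eqP Hcs) ltnn take_size drop_size.
have Huc : uniq (all_labels c).
  have := perm_uniq (all_labels_cat ls cs1 c cs2); rewrite Hu cat_uniq.
  by move/esym/andP => [].
have [] := IH c _ Wc Huc Hxc xc El; first by rewrite mem_cat mem_head orbT.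
move=> t0 [v [u [u' [Hr Hi W0 HC]]]].
exists (BNode ls (cs1 ++ t0 :: cs2)), (size cs1 :: v), u, u'; split => //.
- exact: ReplacedBelow.
- rewrite wf_bucketE s0 sb Hcs implybT Hs !all_cat /= Hl1 Hl2 Hw1 W0 Hw2 /=.
  move: Hlc; rewrite !andbT; case: (labels_inserted Hr Hi) => -> //.
  by rewrite all_rcons => /andP[].
- rewrite !canonicalE !map_cat /= !all_cat /=.
  rewrite (replaced_first_label Hr Hi W0).
  by move=> /andP[-> /and3P[-> /HC[-> ->] ->]].
Qed.

Lemma uniq_map_inj (T S : eqType) (f : T -> S) (s : seq T) :
  uniq (map f s) -> {in s &, injective f}.
Proof.
elim: s => // a s IH /= /andP[/mapP Ha /IH Hs] x y; rewrite !inE.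
move=> /predU1P[->|xs] /predU1P[->|ys] // E; last exact: Hs.
  by case: Ha; exists y.
by case: Ha; exists x.
Qed.

Lemma labels_canon t : labels (canonize t) = labels t.
Proof. by case: t. Qed.

Lemma first_label_canon t : first_label (canonize t) = first_label t.
Proof. by rewrite /first_label labels_canon. Qed.

(** Canonizing a child keeps its first label, so sorting may come first; induction hypotheses on the
    original children then apply directly. *)
Lemma canonizeE ls cs : canonize (BNode ls cs) =
  BNode ls (map canonize (sort (relpre first_label leq) cs)).
Proof.
congr BNode; symmetry; apply: (map_sort (leT' := relpre first_label leq)).
by move=> x y /=; rewrite !first_label_canon.
Qed.

Lemma perm_canon t : perm_eq (all_labels (canonize t)) (all_labels t).
Proof.
elim/btree_nested_ind: t => ls cs IH; rewrite canonizeE /= perm_cat2l.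
set s := sort _ _; have Hs : perm_eq s cs by rewrite perm_sort.
apply: perm_trans (perm_flatten (perm_map _ Hs)).
have {IH Hs}: {in s, forall c, perm_eq (all_labels (canonize c)) (all_labels c)}.
  by move=> c; rewrite (perm_mem Hs); apply: IH.
elim: s => //= c s IHs Hc; apply: perm_cat; first by rewrite Hc ?mem_head.
by apply: IHs => d Hd; apply: Hc; rewrite inE Hd orbT.
Qed.

Lemma wf_canon b t : wf_bucket b (canonize t) = wf_bucket b t.
Proof.
elim/btree_nested_ind: t => ls cs IH; rewrite canonizeE !wf_bucketE.
set s := sort _ _; have Hs : perm_eq s cs by rewrite perm_sort.
rewrite !all_map -!(perm_all _ Hs) -!size_eq0 size_map (perm_size Hs).
do 4 congr (_ && _); congr (_ && _).
  by apply: eq_all => c /=; rewrite labels_canon.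
by apply: eq_in_all => c; rewrite (perm_mem Hs) => /IH.
Qed.

Lemma uniq_child ls cs c :
  uniq (all_labels (BNode ls cs)) -> c \in cs -> uniq (all_labels c).
Proof.
move=> + Hc; case/splitPr: Hc => cs1 cs2.
by rewrite (perm_uniq (all_labels_cat _ _ _ _)) cat_uniq => /andP[].
Qed.

Lemma uniq_first_label b ls cs : wf_bucket b (BNode ls cs) ->
  uniq (all_labels (BNode ls cs)) -> uniq (map first_label cs).
Proof.
rewrite wf_bucketE /= cat_uniq => /and5P[_ _ _ _ /andP[_]] Hw /and3P[_ _].
elim: cs Hw => //= c cs IH /andP[Wc Wcs]; rewrite cat_uniq.
case/and3P=> _ /hasPn Hc /(IH Wcs) ->; rewrite andbT.
apply/mapP => -[d Hd E].
have /Hc/negP[] : first_label d \in flatten (map all_labels cs).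
  apply/flattenP; exists (all_labels d); first exact: map_f.
  by apply: labels_sub; apply: first_label_in (allP Wcs _ Hd).
by rewrite -E; apply: labels_sub; apply: first_label_in Wc.
Qed.

(** Sorting only gives a weak order of first labels; it is strict because the labels are
    distinct. *)
Lemma canonical_canon b t :
  wf_bucket b t -> uniq (all_labels t) -> canonical (canonize t).
Proof.
elim/btree_nested_ind: t => ls cs IH Hw Hu; rewrite canonizeE canonicalE.
rewrite -map_comp (eq_map (g := first_label)); last first.
  by move=> c /=; rewrite first_label_canon.
rewrite (map_sort (leT := leq)) // all_map; apply/andP; split.
  rewrite ltn_sorted_uniq_leq sort_uniq (uniq_first_label Hw Hu).
  exact: sort_sorted leq_total _.
apply/allP => c; rewrite mem_sort => Hc; apply: IH => //; last exact: uniq_child Hu Hc.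
by move: Hw; rewrite wf_bucketE => /and5P[_ _ _ _ /andP[_ /allP]]; apply.
Qed.

Lemma canon_id t : canonical t -> canonize t = t.
Proof.
elim/btree_nested_ind: t => ls cs IH; rewrite canonicalE => /andP[Hs /allP Hk].
rewrite canonizeE sorted_sort; first last.
- by move: Hs; rewrite sorted_map; apply: sub_sorted => x y /= /ltnW.
- by move=> y x z /=; apply: leq_trans.
congr BNode; rewrite -[RHS]map_id; apply/eq_in_map => c Hc.
by rewrite IH // Hk.
Qed.

Lemma tequiv_canon t : tequiv (canonize t) t.
Proof.
elim/btree_nested_ind: t => ls cs IH; rewrite canonizeE.
set s := sort _ _; have Hs : perm_eq s cs by rewrite perm_sort.
apply: (TEquiv _ Hs); have {IH Hs}: {in s, forall c, tequiv (canonize c) c}.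
  by move=> c; rewrite (perm_mem Hs); apply: IH.
elim: s => [|c s IHs] Hc /=; constructor; first by apply: Hc; rewrite mem_head.
by apply: IHs => d Hd; apply: Hc; rewrite inE Hd orbT.
Qed.

Lemma canon_tequiv b t1 t2 : tequiv t1 t2 ->
  wf_bucket b t2 -> uniq (all_labels t2) -> canonize t1 = canonize t2.
Proof.
elim/btree_nested_ind: t2 t1 => ls cs2 IH t1 E Hw Hu.
have [cs1 [cs [-> Hp HF]]] : exists cs1 cs,
    [/\ t1 = BNode ls cs1, perm_eq cs cs2 & List.Forall2 tequiv cs1 cs].
  by inversion E; subst; exists cs1, cs.
have Emap : map canonize cs1 = map canonize cs.
  move: Hw; rewrite wf_bucketE => /and5P[_ _ _ _ /andP[_ /allP Hw]].
  have : {subset cs <= cs2} by move=> c; rewrite (perm_mem Hp).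
  elim: HF => //= c1 c l1 l Ec _ IHl Hsub.
  have Hc : c \in cs2 by apply: Hsub; rewrite mem_head.
  congr cons; last by apply: IHl => d Hd; apply: Hsub; rewrite inE Hd orbT.
  by apply: IH => //; [exact: Hw|exact: uniq_child Hu Hc].
(* Sorting forgets the initial order only if the comparison is antisymmetric on the list; here this
   holds because siblings have distinct first labels. *)
rewrite /= Emap; congr BNode; apply/perm_sort_inP; last exact: perm_map.
- by move=> x y _ _ /=; apply: leq_total.
- by move=> y x z _ _ _ /=; apply: leq_trans.
have Hinj : {in cs2 &, injective first_label}.
  exact: uniq_map_inj (uniq_first_label Hw Hu).
move=> _ _ /mapP[x Hx ->] /mapP[y Hy ->] /=; rewrite !first_label_canon.
rewrite -eqn_leq => /eqP /Hinj ->; by rewrite -?(perm_mem Hp).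
Qed.

(** * Enumeration of the trees *)

(** The map [r] recovers the block an element comes from, so the blocks are disjoint. It will be the
    head of a path, then [locate], then [delete]. *)
Lemma uniq_flatten_fiber (S T : eqType) (F : S -> seq T) (r : T -> S) s :
  uniq s -> {in s, forall a, uniq (F a)} ->
  {in s, forall a, {in F a, forall y, r y = a}} -> uniq (flatten (map F s)).
Proof.
elim: s => //= a s IH /andP[Ha Hs] Hu Hr; rewrite cat_uniq Hu ?mem_head //=.
rewrite IH // ?andbT; last 2 first.
- by move=> c Hc; apply: Hu; rewrite inE Hc orbT.
- by move=> c Hc; apply: Hr; rewrite inE Hc orbT.
apply/hasPn => y /flatten_mapP[c Hc Hy]; apply: contra Ha => Hya.
by rewrite -(Hr a _ y Hya) ?mem_head // (Hr c _ y Hy) // inE Hc orbT.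
Qed.

Fixpoint nodes (t : btree) : seq (seq nat) :=
  let: BNode _ cs := t in
  [::] :: flatten [seq map (cons iv.1) iv.2 |
                   iv <- zip (iota 0 (size cs)) (map nodes cs)].

Lemma nodesE t0 ls cs : nodes (BNode ls cs) = [::] ::
  flatten [seq map (cons i) (nodes (nth t0 cs i)) | i <- iota 0 (size cs)].
Proof.
congr cons; congr flatten.
have -> : zip (iota 0 (size cs)) (map nodes cs) =
    [seq (i, nodes (nth t0 cs i)) | i <- iota 0 (size cs)].
  have sz : size (iota 0 (size cs)) = size (map nodes cs).
    by rewrite size_iota size_map.
  apply: (@eq_from_nth _ (0, [::])).
    by rewrite size_zip !size_map !size_iota minnn.
  move=> i; rewrite size_zip -sz minnn size_iota => Hi.
  by rewrite nth_zip // (nth_map 0) ?size_iota // nth_iota // (nth_map t0).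
by rewrite -map_comp.
Qed.

Lemma mem_nodes t v : (v \in nodes t) = is_node t v.
Proof.
elim: v t => [|i v IH] [ls cs]; first by rewrite (nodesE (BNode [::] [::])).
rewrite (nodesE (BNode ls cs)) /is_node inE /=.
apply/flatten_mapP/idP => [[j]|].
  rewrite mem_iota => /= Hj /mapP[w Hw [Ei Ev]]; subst i w.
  by rewrite Hj -/(is_node _ _) -IH.
case: ifP => // Hi Hv; exists i; first by rewrite mem_iota.
by rewrite map_f // IH.
Qed.

Lemma uniq_nodes t : uniq (nodes t).
Proof.
elim/btree_nested_ind: t => ls cs IH; rewrite (nodesE (BNode ls cs)) /=.
apply/andP; split; first by apply/negP => /flatten_mapP[i _ /mapP[]].
apply: (@uniq_flatten_fiber _ _ _ (head 0)); first exact: iota_uniq.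
  move=> i; rewrite mem_iota => /= Hi; rewrite map_inj_uniq; last by move=> ? ? [].
  by apply: IH; rewrite mem_nth.
by move=> i _ y /mapP[w _ ->].
Qed.

Lemma replaced_subtree t v u u' t' : replaced t v u u' t' -> subtree t' v = Some u'.
Proof.
elim=> {t v u u' t'} // ls cs1 c cs2 p u u' c' _ IH.
by rewrite /= size_cat /= addnS ltnS leq_addr nth_cat ltnn subnn.
Qed.

Section Successors.
Variable b : nat.

Definition insertions (t : btree) (v : seq nat) : seq btree :=
  let x := (tsize t).+1 in
  if subtree t v is Some u then
    if size (labels u) < b then [:: modify (add_label x) t v]
    else [seq modify (add_child x i) t v | i <- iota 0 (size (children u)).+1]
  else [::].

Lemma insertionsP t v t' : t' \in insertions t v <-> insert_at b t v t'.
Proof.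
rewrite /insertions /insert_at; case: (subtree t v) => [u|]; last first.
  by split=> // -[].
split=> [|[_ [<-]]].
  case: ifP => Hu; first by rewrite inE => /eqP E; exists u; rewrite ?Hu.
  case/mapP => i; rewrite mem_iota ltnS => /= Hi E; exists u; rewrite ?Hu //.
  by exists i.
case: ifP => _; first by move->; rewrite mem_head.
move=> [i Hi ->]; apply/mapP; exists i => //.
by rewrite mem_iota ltnS.
Qed.

Lemma uniq_insertions t v : (tsize t).+1 \notin all_labels t ->
  uniq (insertions t v).
Proof.
move=> Hx; rewrite /insertions; case Eu: (subtree t v) => [u|] //.
case: ifP => // Hu; rewrite map_inj_in_uniq ?iota_uniq // => i j.
rewrite !mem_iota !ltnS /= => Hi Hj E.
have Hri := replaced_modify (add_child (tsize t).+1 i) Eu.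
have Hrj := replaced_modify (add_child (tsize t).+1 j) Eu.
have := replaced_subtree Hri; rewrite E (replaced_subtree Hrj) => -[].
have Hxu : (tsize t).+1 \notin all_labels u.
  by apply: contra Hx; apply: replaced_sub Hri _.
case: u Hi Hj Hxu {Eu Hu Hri Hrj} => ls cs /= Hi Hj Hxu [Ecs].
(* The position of an insertion is read off as the index of the new leaf bucket, which differs from
   all older children because its label is fresh. *)
have Hcs k : k <= size cs -> index (BNode [:: (tsize t).+1] [::])
    (take k cs ++ BNode [:: (tsize t).+1] [::] :: drop k cs) = k.
  move=> Hk; rewrite index_cat ifN /= ?eqxx ?addn0 ?size_takel //.
  apply/negP => /mem_take /(notin_all_labels_child Hxu) /=.
  by rewrite inE eqxx.
by rewrite -(Hcs _ Hi) -Ecs Hcs.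
Qed.

Definition successors (t : btree) : seq btree :=
  flatten [seq insertions t v | v <- nodes t].

Lemma successorsP t t' : t' \in successors t <-> exists v, insert_at b t v t'.
Proof.
split=> [/flatten_mapP[v _ /insertionsP Hv]|[v /insertionsP Hv]]; first by exists v.
apply/flatten_mapP; exists v => //; rewrite mem_nodes /is_node.
by move: Hv; rewrite /insertions; case: (subtree t v).
Qed.

Lemma ibt_wf n t : ibt b n t -> wf_bucket b t.
Proof. by case/andP. Qed.

Lemma ibt_uniq n t : ibt b n t -> uniq (all_labels t).
Proof. by case/andP => _ /perm_uniq ->; rewrite iota_uniq. Qed.

Lemma ibt_mem n t y : ibt b n t -> (y \in all_labels t) = (0 < y <= n).
Proof. by case/andP => _ /perm_mem ->; rewrite mem_iota add1n ltnS. Qed.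

Lemma ibt_size n t : ibt b n t -> tsize t = n.
Proof. by case/andP => _ /perm_size; rewrite size_iota. Qed.

Lemma ibt_fresh n t : ibt b n t -> (tsize t).+1 \notin all_labels t.
Proof. by move=> H; rewrite (ibt_size H) (ibt_mem _ H) ltnn andbF. Qed.

Lemma insert_at_delete n t v t' :
  ibt b n t -> insert_at b t v t' -> delete n.+1 t' = t.
Proof.
move=> Ht; have Hx := ibt_fresh Ht; move: Hx; rewrite -(ibt_size Ht) => Hx.
by move=> /insert_atP[u [u' [Hr Hi]]]; apply: delete_inserted Hr Hi (ibt_wf Ht) Hx.
Qed.

Lemma insert_at_locate n t v t' :
  ibt b n t -> insert_at b t v t' -> locate n.+1 t' = v.
Proof.
move=> Ht; have Hx := ibt_fresh Ht; move: Hx; rewrite -(ibt_size Ht) => Hx.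
by move=> /insert_atP[u [u' [Hr Hi]]]; apply: locate_inserted Hr Hi (ibt_wf Ht) Hx.
Qed.

Lemma ibt_insert_at n t v t' : 0 < b ->
  ibt b n t -> insert_at b t v t' -> ibt b n.+1 t'.
Proof.
move=> b0 Ht /insert_atP[u [u' [Hr Hi]]]; rewrite (ibt_size Ht) in Hi.
apply/andP; split.
  apply: wf_inserted Hr Hi b0 (ibt_wf Ht) _.
  by apply/allP => y; rewrite (ibt_mem _ Ht) ltnS => /andP[].
rewrite (perm_trans (perm_inserted Hr Hi)) // perm_sym.
have -> : iota 1 n.+1 = iota 1 n ++ [:: n.+1] by rewrite -{1}(addn1 n) iotaD add1n.
by rewrite perm_catC perm_cons perm_sym; case/andP: Ht.
Qed.

Lemma uniq_successors n t : ibt b n t -> uniq (successors t).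
Proof.
move=> Ht; apply: (@uniq_flatten_fiber _ _ _ (locate n.+1)).
- exact: uniq_nodes.
- by move=> v _; apply: uniq_insertions (ibt_fresh Ht).
- by move=> v _ t' /insertionsP; apply: insert_at_locate.
Qed.

Lemma ibt_pred n t' : ibt b n.+2 t' -> exists t v u u',
  [/\ ibt b n.+1 t, replaced t v u u' t', inserted b n.+2 u u' &
      canonical t' -> canonical t /\ u' = append_label b n.+2 u].
Proof.
move=> Ht'; have Hle : all (fun y => y <= n.+2) (all_labels t').
  by apply/allP => y; rewrite (ibt_mem _ Ht') => /andP[].
have [||t [v [u [u' [Hr Hi Wt Hk]]]]] :=
    ex_inserted (ibt_wf Ht') (ibt_uniq Ht') Hle.
- by rewrite (ibt_mem _ Ht') ltnSn.
(* A root bucket consisting of the maximum alone has no children, so the tree would have size 1. *)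
- apply/eqP => El; have := ibt_size Ht'; have := ibt_wf Ht'.
  case: t' El Hle {Ht'} => l cs /= -> Hle Wt'.
  by rewrite (max_no_children Wt' Hle (mem_head _ _)).
exists t, v, u, u'; split => //; rewrite /ibt Wt /=.
rewrite -(perm_cons n.+2) perm_sym -(permPr (perm_inserted Hr Hi)) perm_sym.
case/andP: Ht' => _ /permPl ->.
have -> : iota 1 n.+2 = iota 1 n.+1 ++ [:: n.+2].
  by rewrite -{1}(addn1 n.+1) iotaD add1n.
by rewrite perm_catC.
Qed.

Lemma ibt_insert_pred n t' : ibt b n.+2 t' ->
  exists2 t, ibt b n.+1 t & exists v, insert_at b t v t'.
Proof.
case/ibt_pred => t [v [u [u' [Ht Hr Hi _]]]]; exists t => //; exists v.
by apply/insert_atP; exists u, u'; rewrite (ibt_size Ht).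
Qed.

Lemma ibt1E t : 0 < b -> ibt b 1 t = (t == root1).
Proof.
move=> b0; apply/idP/eqP => [Ht|->]; last by rewrite /ibt /= b0 perm_refl.
have Wt := ibt_wf Ht; have Hm := fun y => ibt_mem y Ht.
move: (ibt_size Ht).
case: t Wt Hm {Ht} => ls cs Wt Hm Hs.
have Hall : all (fun y => y <= 1) (all_labels (BNode ls cs)).
  by apply/allP => y; rewrite Hm => /andP[].
have [y Hy] : exists y, y \in ls by exists (head 0 ls); exact: first_label_in Wt.
have y1 : y = 1.
  have : y \in all_labels (BNode ls cs) by rewrite /= mem_cat Hy.
  by rewrite Hm; case: (y) => [|[]].
subst y; have E := max_no_children Wt Hall Hy; subst cs.
move: Hs; rewrite /Defs.tsize /= cats0.
by case: ls Hy {Wt Hm Hall} => [|a [|]] //; rewrite inE => /eqP <-.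
Qed.

(** Size 0 gives no tree, since buckets are nonempty; the recursion therefore starts at size 1. *)
Fixpoint ibt_enum (n : nat) : seq btree :=
  if n is m.+1 then
    if m is 0 then [:: root1] else flatten [seq successors t | t <- ibt_enum m]
  else [::].

Lemma mem_ibt_enum n t : 0 < b -> (t \in ibt_enum n) = ibt b n t.
Proof.
move=> b0; elim: n t => [|[|n] IH] t.
- rewrite in_nil; apply/esym/negP => /[dup] /ibt_size + /ibt_wf.
  by case: t => -[|a l] cs.
- by rewrite ibt1E // inE.
- rewrite [ibt_enum _]/=; apply/flatten_mapP/idP => [[t0]|].
    by rewrite IH => Ht0 /successorsP[v]; apply: ibt_insert_at.
  by move=> /ibt_insert_pred[t0 Ht0 Hv]; exists t0; [rewrite IH|apply/successorsP].
Qed.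

Lemma uniq_ibt_enum n : 0 < b -> uniq (ibt_enum n).
Proof.
move=> b0; elim: n => [|[|n] IH] //.
apply: (@uniq_flatten_fiber _ _ successors (delete n.+2) (ibt_enum n.+1)) => //.
  by move=> t; rewrite mem_ibt_enum // => Ht; apply: uniq_successors Ht.
move=> t; rewrite mem_ibt_enum // => Ht t' /successorsP[v].
exact: insert_at_delete.
Qed.
End Successors.

(** * Histories of the growth process *)

Section Growth.
Variable b : nat.
Hypothesis b_gt0 : 0 < b.

Lemma inserted_append x u : inserted b x u (append_label b x u).
Proof.
rewrite /inserted /append_label; case: (_ < b) => //.
by exists (size (children u)).
Qed.

Lemma gstepP t v t' : gstep b t v = Some t' <->
  exists u, replaced t v u (append_label b (tsize t).+1 u) t'.
Proof.
rewrite gstepE; split=> [|[u Hr]].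
  case Eu: (subtree t v) => [u|] //= [<-]; exists u.
  exact: replaced_modify.
by have [-> ->] := replacedP (f := append_label _ _) Hr.
Qed.

Lemma gstep_insert_at t v t' : gstep b t v = Some t' -> insert_at b t v t'.
Proof.
move=> /gstepP[u Hr]; apply/insert_atP; exists u, (append_label b (tsize t).+1 u).
by split=> //; apply: inserted_append.
Qed.

(** A new last child has the largest first label among its siblings, and the first labels of
    existing nodes do not change. *)
Lemma canonical_append x t v u t' : replaced t v u (append_label b x u) t' ->
  wf_bucket b t -> all (fun y => y < x) (all_labels t) ->
  canonical t -> canonical t'.
Proof.
(* The index of [replaced] must be a variable for the induction. *)
have [u' Eu'] : exists u', u' = append_label b x u by eexists.
rewrite -Eu' => Hr.
elim: Hr Eu' => {t v u u' t'} [[ls cs] u' ->|ls cs1 c cs2 p u u' c' Hr IH E].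
  rewrite wf_bucketE => /and5P[_ _ _ _ /andP[_ /allP Hw]] /allP Hx.
  rewrite /append_label; case: ifP => // _; rewrite /= take_size drop_size.
  rewrite !canonicalE map_cat !all_cat /= => /andP[Hs ->].
  rewrite !(sorted_pairwise ltn_trans) pairwise_cat allrel1r in Hs *.
  rewrite Hs /= !andbT; apply/allP => _ /mapP[c Hc ->] /=; apply: Hx.
  rewrite mem_cat; apply/orP; right; apply/flatten_mapP; exists c => //.
  by apply: labels_sub; apply: first_label_in (Hw c Hc).
rewrite wf_bucketE => /and5P[_ _ _ _ /andP[_]].
rewrite !all_cat /= map_cat flatten_cat /= !all_cat.
move=> /and3P[_ Wc _] /and4P[_ _ Hx _].
rewrite !canonicalE !map_cat !all_cat /= => /andP[Hs /and3P[-> Kc ->]].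
rewrite (IH E Wc Hx Kc) (replaced_first_label (b := b) (x := x) Hr) ?Hs //.
by rewrite E; apply: inserted_append.
Qed.

Lemma grow_rcons vs v t :
  grow b (rcons vs v) t = obind (gstep b ^~ v) (grow b vs t).
Proof.
by elim: vs t => [|w vs IH] t /=; [case: gstep|case: gstep => //= t'; rewrite IH].
Qed.

Lemma grow_ibt vs t : grow b vs root1 = Some t ->
  ibt b (size vs).+1 t /\ canonical t.
Proof.
elim/last_ind: vs t => [|vs v IH] t; first by case=> <-; rewrite ibt1E.
rewrite grow_rcons size_rcons; case E: (grow b vs root1) => [t0|] //= Hg.
have [Ht0 K0] := IH _ E; split; first exact: ibt_insert_at (gstep_insert_at Hg).
have [u Hr] := (gstepP _ _ _).1 Hg.
apply: (canonical_append Hr (ibt_wf Ht0)) => //.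
by apply/allP => y; rewrite (ibt_size Ht0) (ibt_mem _ Ht0) ltnS => /andP[].
Qed.

(** The final tree yields its predecessor by [delete] and the last chosen node by [locate]; the
    equal lengths are read off from its size. *)
Lemma grow_inj vs1 vs2 t :
  grow b vs1 root1 = Some t -> grow b vs2 root1 = Some t -> vs1 = vs2.
Proof.
move=> H1 H2; have: size vs1 = size vs2.
  have [/ibt_size + _] := grow_ibt H1; have [/ibt_size + _] := grow_ibt H2.
  by move=> -> [].
elim/last_ind: vs1 vs2 t H1 H2 => [|vs1 v1 IH] vs2 t; first by case: vs2.
case/lastP: vs2 => [|vs2 v2]; first by rewrite size_rcons.
rewrite !grow_rcons !size_rcons.
case E1: (grow b vs1 root1) => [t1|] //=; case E2: (grow b vs2 root1) => [t2|] //=.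
move=> /gstep_insert_at H1 /gstep_insert_at H2 [Es].
have [Ht1 _] := grow_ibt E1; have [Ht2 _] := grow_ibt E2.
rewrite -Es in Ht2.
have Et : t1 = t2.
  by rewrite -(insert_at_delete Ht1 H1) (insert_at_delete Ht2 H2).
rewrite -(insert_at_locate Ht1 H1) (insert_at_locate Ht2 H2).
by rewrite -Et in E2; rewrite (IH _ _ E1 E2 Es).
Qed.

Lemma grow_surj n t : ibt b n.+1 t -> canonical t ->
  exists vs, grow b vs root1 = Some t.
Proof.
elim: n t => [|n IH] t Ht Kt.
  by exists [::]; move: Ht; rewrite ibt1E // => /eqP ->.
have [t0 [v [u [u' [Ht0 Hr _ /(_ Kt)[K0 Eu']]]]]] := ibt_pred Ht; subst u'.
have [vs Evs] := IH _ Ht0 K0; exists (rcons vs v).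
by rewrite grow_rcons Evs; apply/gstepP; exists u; rewrite (ibt_size Ht0).
Qed.

(** Reduces the sum over histories in [growth_law] to a single term. *)
Lemma grow_canon n t : 0 < n -> ibt b n t ->
  exists2 vs, grow b vs root1 = Some (canonize t) &
    forall ws, (exists2 t', grow b ws root1 = Some t' & tequiv t' t) <-> ws = vs.
Proof.
case: n => // n _ Ht; have [Wt Ut] := (ibt_wf Ht, ibt_uniq Ht).
have [vs Evs] : exists vs, grow b vs root1 = Some (canonize t).
  apply: (@grow_surj n); last exact: canonical_canon Wt Ut.
  by case/andP: Ht => _ Hp; rewrite /ibt wf_canon Wt (perm_trans (perm_canon t)).
exists vs => // ws; split=> [[t' Et' Eq]|->]; last first.
  by exists (canonize t) => //; apply: tequiv_canon.
have [_ Kt'] := grow_ibt Et'; apply: (grow_inj Et').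
by rewrite -(canon_id Kt') (canon_tequiv Eq Wt Ut).
Qed.
End Growth.

(** * Weights *)

Import GRing.Theory Num.Theory.
Local Open Scope ring_scope.

Section NodeProduct.
Variable R : comPzRingType.

(** Common form of [weight] and [degfact]: a product over nodes of a function of capacity and
    out-degree. *)
Fixpoint node_prod (g : nat -> nat -> R) (t : btree) : R :=
  let: BNode ls cs := t in
  g (size ls) (size cs) * \prod_(x <- map (node_prod g) cs) x.

Lemma node_prodE g ls cs : node_prod g (BNode ls cs) =
  g (size ls) (size cs) * \prod_(c <- cs) node_prod g c.
Proof. by rewrite /= big_map. Qed.

(** Nodes outside the replaced subtree keep capacity and out-degree, hence contribute a common
    factor. The multiplier [a] avoids dividing by a weight that may vanish. *)
Lemma node_prod_replaced g a t v u u' t' : replaced t v u u' t' ->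
  node_prod g u' = a * node_prod g u -> node_prod g t' = a * node_prod g t.
Proof.
elim=> {t v u u' t'} // ls cs1 c cs2 p u u' c' _ IH /IH E.
rewrite !node_prodE !big_cat !big_cons E !size_cat /=; ring.
Qed.

Lemma node_prodM g h t :
  node_prod (fun c d => g c d * h c d) t = node_prod g t * node_prod h t.
Proof.
elim/btree_nested_ind: t => ls cs IH; rewrite !node_prodE.
by rewrite (eq_big_seq _ IH) big_split mulrACA.
Qed.

Lemma node_prod_canon g t : node_prod g (canonize t) = node_prod g t.
Proof.
elim/btree_nested_ind: t => ls cs IH; rewrite canonizeE !node_prodE.
rewrite big_map size_map size_sort; congr (_ * _).
rewrite (eq_big_seq (node_prod g)); last by move=> c; rewrite mem_sort => /IH.
by apply: perm_big; rewrite perm_sort.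
Qed.

Lemma node_prod_add_label g x ls :
  node_prod g (add_label x (BNode ls [::])) = g (size ls).+1 0.
Proof. by rewrite /= size_rcons big_nil mulr1. Qed.

Lemma node_prod_add_child g x i ls cs : (i <= size cs)%N -> g 1%N 0%N = 1 ->
  node_prod g (add_child x i (BNode ls cs)) =
  g (size ls) (size cs).+1 * \prod_(c <- cs) node_prod g c.
Proof.
move=> Hi g1; rewrite node_prodE big_cat big_cons /= g1 big_nil !mul1r -big_cat.
by rewrite size_cat /= size_takel // size_drop cat_take_drop addnS subnKC.
Qed.
End NodeProduct.

Lemma degfact_node_prod (R : comPzRingType) t :
  (degfact t)%:R = node_prod (fun _ d => (d`!)%:R : R) t.
Proof.
elim/btree_nested_ind: t => ls cs IH; rewrite node_prodE /= natrM big_map.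
by rewrite natr_prod (eq_big_seq _ IH).
Qed.

(** * The common recurrence of the three weight families *)

Section Attraction.
Variables (R : realType) (b : nat) (fam : bfamily R).
Hypotheses (b_gt0 : (0 < b)%N) (Hfam : fam_ok fam).

Definition slope : R :=
  match fam with BRT => 1 | BDary d => (d.-1)%:R | BPORT a => a + 1 end.

Definition offset : R :=
  match fam with BRT => 0 | BDary _ => 1 | BPORT _ => -1 end.

Definition attraction (c d : nat) : R := slope * c%:R + offset * (1 - d%:R).

(** Common closed form, for positive indices, of [T_n], of [psi_n], and of [phi_0] at [n = b]. *)
Definition rising (n : nat) : R := \prod_(1 <= j < n) (slope * j%:R + offset).

Lemma slope_gt0 : 0 < slope.
Proof.
move: Hfam; rewrite /slope; case: fam => [_|d|a] /=; first exact: ltr01.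
  by case: d => [|[|d]] // _; rewrite ltr0n.
by move=> a0; rewrite addr_gt0.
Qed.

Lemma risingS n : (0 < n)%N -> rising n.+1 = (slope * n%:R + offset) * rising n.
Proof. by move=> n0; rewrite /rising big_nat_recr //= mulrC. Qed.

Lemma gbinom_rising (s g : R) m : s != 0 ->
  (m`!)%:R * s ^+ m * gbinom (m%:R + g / s) m =
  \prod_(1 <= j < m.+1) (s * j%:R + g).
Proof.
move=> s0; rewrite /gbinom mulrC -!mulrA mulKf ?pnatr_eq0 -?lt0n ?fact_gt0 //.
have -> : s ^+ m = \prod_(i < m) s by rewrite prodr_const card_ord.
rewrite big_add1 /= big_mkord -big_split /=.
(* Read backwards, the factor [(m + g / s - i) * s] of the binomial becomes [s * (i + 1) + g]. *)
rewrite (reindex_inj rev_ord_inj) /=; apply: eq_bigr => i _.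
by rewrite natrB //; field.
Qed.

Lemma natr_fact_prod m : (m`!)%:R = \prod_(1 <= j < m.+1) (1 * j%:R + 0) :> R.
Proof.
rewrite fact_prod natr_prod; apply: eq_bigr => i _; by rewrite mul1r addr0.
Qed.

Lemma Tn_formulaE n : (0 < n)%N -> Tn_formula fam n = rising n.
Proof.
case: n => // m _; have := slope_gt0; rewrite /Tn_formula /rising /slope /offset.
case: fam => [_|d|a] /=; first exact: natr_fact_prod.
  by move=> /lt0r_neq0 s0; rewrite -gbinom_rising // mul1r.
by move=> /lt0r_neq0 s0; rewrite -gbinom_rising // mulN1r.
Qed.

Lemma psiwE k : (0 < k)%N -> psiw fam k = rising k.
Proof. exact: Tn_formulaE. Qed.

Lemma phiw0 : phiw b fam 0 = rising b.
Proof.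
rewrite -Tn_formulaE // /phiw /Tn_formula; case: fam => [|d|a].
- by rewrite expr0 mulr1 divr1.
- by rewrite bin0 mulr1.
- by rewrite {2}/gbinom big_ord0 divr1 mulr1.
Qed.

Lemma gbinomS (s : R) k :
  k.+1%:R * gbinom (s + k.+1%:R) k.+1 = (s + k.+1%:R) * gbinom (s + k%:R) k.
Proof.
rewrite /gbinom big_ord_recl subr0 factS natrM invfM.
have -> : \prod_(i < k) (s + k.+1%:R - (lift ord0 i)%:R) =
    \prod_(i < k) (s + k%:R - i%:R).
  by apply: eq_bigr => i _; rewrite lift0 -(addn1 i) -(addn1 k) !natrD; ring.
by field; rewrite nat1r !pnatr_eq0 -lt0n fact_gt0.
Qed.

Lemma phiwS k : k.+1%:R * phiw b fam k.+1 = attraction b k * phiw b fam k.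
Proof.
rewrite /attraction /slope /offset /phiw; move: Hfam; case: fam => [_|d|a _] /=.
- rewrite factS natrM exprS; field; by rewrite nat1r !pnatr_eq0 -lt0n fact_gt0.
- move=> d2; set A := _ * gbinom _ _; rewrite mulrCA [RHS]mulrCA; congr (_ * _).
  have := mul_bin_left (b * d.-1 + 1) k => /(congr1 (fun n => n%:R : R)).
  (* The subtraction in [mul_bin_left] is truncated; once it truncates, the binomial coefficient
     itself vanishes. *)
  rewrite !natrM => ->; have [kb|kb] := leqP k (b * d.-1 + 1).
    by rewrite natrB // natrD natrM; ring.
  by rewrite bin_small // !mulr0.
- set A := _ * gbinom _ b.-1; rewrite mulrCA [RHS]mulrCA; congr (_ * _).
  by rewrite gbinomS -(addn1 k) natrD; ring.
Qed.
End Attraction.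

(** * Attraction probabilities, total weights and the two laws *)

Section Laws.
Variables (R : realType) (b : nat) (fam : bfamily R).
Hypotheses (b_gt0 : (0 < b)%N) (Hfam : fam_ok fam).
Local Notation attraction := (attraction fam).
Local Notation rising := (rising fam).

Definition factor (c d : nat) : R := if c == b then phiw b fam d else psiw fam c.

Definition attraction_at (t : btree) (v : seq nat) : R :=
  if subtree t v is Some u then attraction (size (labels u)) (size (children u))
  else 0.

Lemma fweightE t : fweight b fam t = node_prod factor t.
Proof.
elim/btree_nested_ind: t => ls cs IH; rewrite node_prodE /fweight /= big_map.
by rewrite (eq_big_seq _ IH).
Qed.

Lemma factor0 c : (0 < c <= b)%N -> factor c 0 = rising c.
Proof.
case/andP => c0 cb; rewrite /factor; case: eqP => [->|_]; first exact: phiw0.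
exact: psiwE.
Qed.

Lemma factor_label c : (0 < c < b)%N ->
  factor c.+1 0 = attraction c 0 * factor c 0.
Proof.
case/andP => c0 cb; rewrite !factor0 ?c0 ?(ltnW cb) // risingS //.
by rewrite /attraction subr0 mulr1.
Qed.

Lemma factor_child d : d.+1%:R * factor b d.+1 = attraction b d * factor b d.
Proof. by rewrite /factor eqxx phiwS. Qed.

Lemma factor10 : factor 1 0 = 1.
Proof. by rewrite factor0 // /rising big_geq. Qed.

Lemma unsaturated_leaf ls cs : wf_bucket b (BNode ls cs) -> (size ls < b)%N ->
  cs = [::].
Proof.
rewrite wf_bucketE => /and5P[_ _ Hcs _ _] lt_b.
by move: Hcs; rewrite ltn_eqF // implybF negbK => /eqP.
Qed.

Lemma saturated ls cs : wf_bucket b (BNode ls cs) -> (size ls < b)%N = false ->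
  size ls = b.
Proof.
rewrite wf_bucketE => /and5P[_ sb _ _ _] /negbT; rewrite -leqNgt => bs.
by apply/eqP; rewrite eqn_leq sb.
Qed.

Lemma fweight_insertions t v : wf_bucket b t ->
  \sum_(t' <- insertions b t v) fweight b fam t' =
  attraction_at t v * fweight b fam t.
Proof.
rewrite /insertions /attraction_at => Wt.
case Eu: (subtree t v) => [[ls cs]|]; last by rewrite big_nil mul0r.
have Wu := replaced_wf (replaced_modify id Eu) Wt.
rewrite [labels _]/= [children _]/=; case: ifP => Hb.
  have Ecs := unsaturated_leaf Wu Hb; subst cs.
  rewrite big_cons big_nil addr0 !fweightE.
  apply: node_prod_replaced (replaced_modify _ Eu) _.
  rewrite node_prod_add_label node_prodE big_nil mulr1 factor_label // Hb andbT.
  by move: Wu; rewrite wf_bucketE => /and5P[].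
have Eb := saturated Wu Hb.
(* All [d + 1] positions give the same weight, so each gets an equal share of the attraction. *)
rewrite big_map (eq_big_seq (fun=> attraction (size ls) (size cs) /
    (size cs).+1%:R * fweight b fam t)); last first.
  move=> i; rewrite mem_iota ltnS => /= Hi; rewrite !fweightE.
  apply: node_prod_replaced (replaced_modify _ Eu) _.
  rewrite node_prod_add_child ?factor10 // node_prodE Eb mulrA; congr (_ * _).
  by rewrite mulrAC -factor_child mulrC mulKf ?pnatr_eq0.
rewrite big_const_seq count_predT size_iota iter_addr_0.
by rewrite -[LHS]mulr_natl mulrA mulrCA divff ?mulr1 ?pnatr_eq0.
Qed.

(** By induction each of the [d] child subtrees contributes one [offset], which cancels the
    [- d * offset] in the attraction of the root. *)
Lemma sum_attraction t : \sum_(v <- nodes t) attraction_at t v =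
  slope fam * (tsize t)%:R + offset fam.
Proof.
elim/btree_nested_ind: t => ls cs IH; rewrite (nodesE (BNode ls cs)).
rewrite big_cons {1}/attraction_at /= big_flatten /= big_map.
under eq_bigr do rewrite big_map.
rewrite (eq_big_seq (fun i => slope fam *
    (tsize (nth (BNode ls cs) cs i))%:R + offset fam)); last first.
  move=> i; rewrite mem_iota => /= Hi; rewrite -IH ?mem_nth //.
  by apply: eq_bigr => v _; rewrite /attraction_at /= Hi.
have -> : \sum_(i <- iota 0 (size cs)) (slope fam *
    (tsize (nth (BNode ls cs) cs i))%:R + offset fam) =
    \sum_(c <- cs) (slope fam * (tsize c)%:R + offset fam).
  by rewrite [RHS](big_nth (BNode ls cs)) /index_iota subn0.
have -> : (tsize (BNode ls cs))%:R = (size ls)%:R + \sum_(c <- cs) (tsize c)%:R :> R.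
  rewrite /Defs.tsize /= size_cat natrD; congr (_ + _).
  by rewrite size_flatten /shape -map_comp sumnE big_map natr_sum.
rewrite big_split /= -mulr_sumr big_const_seq count_predT iter_addr_0 -mulr_natr.
by rewrite /attraction; ring.
Qed.

Lemma pgrowthE t v : is_node t v -> pgrowth fam t v =
  attraction_at t v / (slope fam * (tsize t)%:R + offset fam).
Proof.
rewrite /is_node /pgrowth /attraction_at /attraction /slope /offset.
case: (subtree t v) => // u _; case: fam => [|d|a].
- by rewrite !mul1r mul0r !addr0.
- by congr (_ / _); ring.
- by congr (_ / _); ring.
Qed.

Lemma fweight_successors t : wf_bucket b t ->
  \sum_(t' <- successors b t) fweight b fam t' =
  (slope fam * (tsize t)%:R + offset fam) * fweight b fam t.
Proof.
move=> Wt; rewrite big_flatten big_map -sum_attraction mulr_suml.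
by apply: eq_bigr => v _; apply: fweight_insertions.
Qed.

(** Numerator and denominator both carry the factor [w(T)]; it is cancelled here, whence the
    nonvanishing hypothesis. *)
Lemma pT_pgrowth n t v : ibt b n t -> fweight b fam t != 0 -> is_node t v ->
  pT b fam t v = pgrowth fam t v.
Proof.
move=> Ht w0 Hv; rewrite /pT pgrowthE //.
have -> : [set t' | insert_at b t v t']%classic = [set` insertions b t v]%classic.
  by apply/seteqP; split=> t' /=; rewrite insertionsP.
have -> : [set t' | exists v', insert_at b t v' t']%classic =
    [set` successors b t]%classic.
  by apply/seteqP; split=> t' /=; rewrite successorsP.
rewrite -!fsbig_seq; last 2 first.
- exact: uniq_successors Ht.
- exact: uniq_insertions (ibt_fresh Ht).
have Wt := ibt_wf Ht.
by rewrite fweight_insertions // fweight_successors // -mulf_div divff // mulr1.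
Qed.

Lemma TtotE n : Ttot b fam n = \sum_(t <- ibt_enum b n) fweight b fam t.
Proof.
rewrite /Ttot; have -> : [set t | ibt b n t]%classic = [set` ibt_enum b n]%classic.
  by apply/seteqP; split=> t /=; rewrite mem_ibt_enum.
by rewrite -fsbig_seq // uniq_ibt_enum.
Qed.

Lemma Ttot_rising n : (0 < n)%N -> Ttot b fam n = rising n.
Proof.
case: n => // n _; rewrite TtotE; elim: n => [|n IH].
  by rewrite big_cons big_nil addr0 fweightE node_prodE big_nil mulr1 factor10 /rising big_geq.
rewrite risingS // -IH.
have -> : ibt_enum b n.+2 =
    flatten [seq successors b t | t <- ibt_enum b n.+1] by [].
rewrite big_flatten big_map mulr_sumr.
apply: eq_big_seq => t; rewrite mem_ibt_enum // => Ht.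
by rewrite fweight_successors ?(ibt_wf Ht) // (ibt_size Ht).
Qed.

Definition unordered_weight (t : btree) : R := fweight b fam t * (degfact t)%:R.

Lemma unordered_weightE t :
  unordered_weight t = node_prod (fun c d => factor c d * (d`!)%:R) t.
Proof. by rewrite node_prodM -degfact_node_prod -fweightE. Qed.

(** The growth process performs just one of the [d + 1] insertions; passing from [d!] to [(d + 1)!]
    supplies the missing factor. *)
Lemma unordered_weight_gstep t v t' : wf_bucket b t -> gstep b t v = Some t' ->
  unordered_weight t' = attraction_at t v * unordered_weight t.
Proof.
move=> Wt; rewrite gstepE /attraction_at.
case Eu: (subtree t v) => [[ls cs]|] //= [<-].
have Wu := replaced_wf (replaced_modify id Eu) Wt.
rewrite !unordered_weightE; apply: node_prod_replaced (replaced_modify _ Eu) _.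
rewrite /append_label [labels _]/= [children _]/=; case: ifP => Hb.
  have Ecs := unsaturated_leaf Wu Hb; subst cs.
  rewrite node_prod_add_label node_prodE big_nil mulr1 /= factor_label ?mulrA // Hb andbT.
  by move: Wu; rewrite wf_bucketE => /and5P[].
have Eb := saturated Wu Hb.
rewrite node_prod_add_child ?factor10 ?mulr1 // node_prodE Eb mulrA; congr (_ * _).
by rewrite factS natrM mulrA [factor _ _ * _]mulrC factor_child mulrA.
Qed.

Lemma gprob_rcons vs v t t1 t2 :
  grow b vs t = Some t1 -> gstep b t1 v = Some t2 ->
  gprob b fam (rcons vs v) t = gprob b fam vs t * pgrowth fam t1 v.
Proof.
move=> + Hg; elim: vs t => [|w vs IH] t /=.
  by case=> ->; rewrite Hg mulr1 mul1r.
by case: gstep => // t0 /IH ->; rewrite mulrA.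
Qed.

Lemma gprobE vs t : grow b vs root1 = Some t ->
  gprob b fam vs root1 = unordered_weight t / rising (size vs).+1.
Proof.
elim/last_ind: vs t => [|vs v IH] t.
  case=> <-; rewrite unordered_weightE node_prodE big_nil !mulr1 factor10.
  by rewrite /rising big_geq // divr1.
rewrite grow_rcons; case E: (grow b vs root1) => [t0|] //= Hg.
have [Ht0 _] := grow_ibt b_gt0 E.
rewrite (gprob_rcons E Hg) (IH _ E) (unordered_weight_gstep (ibt_wf Ht0) Hg).
have Hv : is_node t0 v.
  by move: Hg; rewrite gstepE /is_node; case: (subtree t0 v).
rewrite pgrowthE // (ibt_size Ht0) size_rcons [rising _.+2]risingS //.
by rewrite mulf_div mulrC [_ * rising _]mulrC mulrC [attraction_at _ _ * _]mulrC.
Qed.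

Lemma unordered_weight_canon t : unordered_weight (canonize t) = unordered_weight t.
Proof. by rewrite !unordered_weightE node_prod_canon. Qed.

Lemma growth_law_model n t : (0 < n)%N -> ibt b n t ->
  growth_law b fam t = model_law b fam t.
Proof.
move=> n0 Ht; have [vs Evs Hvs] := grow_canon b_gt0 n0 Ht.
rewrite /growth_law; have -> : [set ws | exists2 t', grow b ws root1 = Some t' &
    tequiv t' t]%classic = [set vs]%classic.
  by apply/seteqP; split=> ws /= /Hvs.
rewrite fsbig_set1 (gprobE Evs) unordered_weight_canon /model_law.
have [/ibt_size Ec _] := grow_ibt b_gt0 Evs.
have Es : (size vs).+1 = n.
  by rewrite -Ec -(ibt_size Ht); apply: perm_size; apply: perm_canon.
by rewrite Es (ibt_size Ht) Ttot_rising.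
Qed.
End Laws.

(** * Binomial and logarithmic series *)

Import Order.TTheory numFieldNormedType.Exports.
Local Open Scope classical_set_scope.

Section Series.
Variable R : realType.
Implicit Types (c a : nat -> R) (s x u : R).

Lemma ratio_cvg0 a (q : R) (n0 : nat) : 0 <= q < 1 ->
  (forall n, (n0 <= n)%N -> `|a n.+1| <= q * `|a n|) -> a @ \oo --> (0 : R).
Proof.
move=> /andP[q0 q1] Ha; apply/norm_cvg0P; rewrite -(cvg_shiftn n0).
have Hq n : `|a (n + n0)%N| <= geometric `|a n0| q n.
  elim: n => [|n IH] /=; first by rewrite expr0 mulr1.
  rewrite addSn (le_trans (Ha _ (leq_addl _ _))) // exprS mulrCA.
  by rewrite ler_wpM2l.
apply: (@squeeze_cvgr _ _ _ _ (cst 0) (geometric `|a n0| q)).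
- by near=> n; rewrite normr_ge0 Hq.
- exact: cvg_cst.
- by apply: cvg_geometric; rewrite ger0_norm.
Unshelve. all: by end_near.
Qed.

(** The shift by one matches the error bounds below, which concern the partial sums [p N.+1]. *)
Lemma cvg_dist_le (f e : nat -> R) (l : R) :
  (forall n, `|f n.+1 - l| <= e n) -> e @ \oo --> (0 : R) -> f @ \oo --> l.
Proof.
move=> Hf He; rewrite -cvg_shiftS; apply/subr_cvg0/norm_cvg0P.
apply: (@squeeze_cvgr _ _ _ _ (cst 0) e) => //; last exact: cvg_cst.
by near=> n; rewrite normr_ge0 Hf.
Unshelve. all: by end_near.
Qed.

Lemma norm_sub_le_deriv (f df : R -> R) (K x : R) :
  (forall u, `|u| <= `|x| -> is_derive u 1 f (df u)) ->
  (forall u, `|u| <= `|x| -> `|df u| <= K) ->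
  `|f x - f 0| <= K * `|x|.
Proof.
move=> Hf HK.
have Hcont (a b : R) : (forall u, u \in `[a, b]%R -> `|u| <= `|x|) ->
    {within `[a, b], continuous f}.
  move=> H; apply: derivable_within_continuous => u /H /Hf Hd.
  exact: ex_derive.
have [x0|x0] := leP 0 x.
  have H u : u \in `[0, x]%R -> `|u| <= `|x|.
    by rewrite in_itv /= => /andP[? ?]; rewrite !ger0_norm.
  have Hd u : u \in `]0, x[%R -> is_derive u 1 f (df u).
    by move=> Hu; apply/Hf/H; apply: subset_itv_oo_cc.
  have [u Hu ->] := MVT_segment x0 Hd (Hcont _ _ H).
  by rewrite normrM subr0 ler_wpM2r // HK // H.
have H u : u \in `[x, 0]%R -> `|u| <= `|x|.
  rewrite in_itv /= => /andP[? ?].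
  by rewrite !ler0_norm ?lerN2 // ltW.
have Hd u : u \in `]x, 0[%R -> is_derive u 1 f (df u).
  by move=> Hu; apply/Hf/H; apply: subset_itv_oo_cc.
have [u Hu E] := MVT_segment (ltW x0) Hd (Hcont _ _ H).
by rewrite distrC E normrM sub0r normrN ler_wpM2r // HK // H.
Qed.

Lemma one_sub_gt0 x u : `|x| < 1 -> `|u| <= `|x| -> 0 < 1 - `|x| <= 1 - u.
Proof.
move=> x1 ux; rewrite subr_gt0 x1 lerD2l lerN2.
exact: le_trans (ler_norm u) ux.
Qed.

Lemma is_derive_ln_one_sub u : u < 1 ->
  is_derive u 1 (fun y : R => ln (1 - y)) (- (1 - u)^-1).
Proof.
move=> u1; have Hd : is_derive (1 - u) 1 (@ln R) (1 - u)^-1.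
  by apply: is_derive1_ln; rewrite subr_gt0.
have Hs : is_derive u 1 (fun y : R => 1 - y) (-1).
  by apply: is_derive_eq; rewrite add0r mul1r.
have := @is_derive1_comp _ (@ln R) (fun y => 1 - y) u _ _ Hd Hs.
by rewrite mulrN1.
Qed.

Lemma log_series x : `|x| < 1 ->
  (fun N => \sum_(1 <= k < N) x ^+ k / k%:R) @ \oo --> - ln (1 - x).
Proof.
move=> x1; pose p N : {poly R} := \sum_(1 <= k < N) k%:R^-1 *: 'X^k.
have pE N y : (p N).[y] = \sum_(1 <= k < N) y ^+ k / k%:R.
  rewrite horner_sum; apply: eq_bigr => k _.
  by rewrite hornerZ hornerXn mulrC.
(* The derivative of [p N.+1] is a finite geometric sum, so adding [ln (1 - u)] leaves the
   derivative [- u ^ N / (1 - u)]. *)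
have dpE N : (1 - 'X) * (p N.+1)^`() = 1 - 'X^N.
  elim: N => [|N IH]; first by rewrite /p big_geq // deriv0 mulr0 subrr.
  rewrite /p big_nat_recr //= -/(p _) derivD mulrDr IH derivZ derivXn /=.
  rewrite -scalerMnr scalerMnl -(mulr_natr (N.+1%:R^-1)).
  by rewrite mulVf ?pnatr_eq0 // scale1r exprS; ring.
have Hb N : `|(p N.+1).[x] + ln (1 - x)| <= `|x| ^+ N / (1 - `|x|) * `|x|.
  have -> : (p N.+1).[x] + ln (1 - x) =
      (p N.+1).[x] + ln (1 - x) - ((p N.+1).[0] + ln (1 - 0)).
    rewrite subr0 ln1 (pE _ 0) big_nat big1 ?addr0 ?subr0 // => k /andP[k0 _].
    by rewrite expr0n gtn_eqF // mul0r.
  apply: (norm_sub_le_deriv (f := fun y => (p N.+1).[y] + ln (1 - y))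
    (df := fun u => - (u ^+ N / (1 - u)))) => u Hu;
    have /andP[x0 xu] := one_sub_gt0 x1 Hu.
    have u1 : u < 1 by rewrite -subr_gt0 (lt_le_trans x0).
    have Hd := is_derive_ln_one_sub u1.
    apply: is_derive_eq.
    have := congr1 (horner^~ u) (dpE N); rewrite !hornerE /= => E.
    have u0 : 1 - u != 0 by rewrite subr_eq0 gt_eqF.
    by apply: (mulfI u0); rewrite mulrDr E; field.
  rewrite normrN normrM normfV normrX (ger0_norm (le_trans (ltW x0) xu)).
  apply: ler_pM => //; rewrite ?exprn_ge0 ?invr_ge0 ?(le_trans (ltW x0)) //.
    by rewrite lerXn2r ?nnegrE.
  by rewrite lef_pV2 ?posrE // (lt_le_trans x0).
apply: (cvg_dist_le (e := fun N => `|x| ^+ N * (`|x| / (1 - `|x|)))).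
  by move=> N; rewrite -pE opprK (le_trans (Hb N)) // mulrAC mulrA.
rewrite -(mul0r (`|x| / (1 - `|x|))); apply: cvgMr_tmp.
by apply: cvg_expr; rewrite normr_id.
Qed.

(** Below, [1 - u >= 1 - |x|]; above, [1 - u <= 1 + |x| <= 1 / (1 - |x|)]. *)
Lemma norm_ln_one_sub_le x u : `|x| < 1 -> `|u| <= `|x| ->
  `|ln (1 - u)| <= - ln (1 - `|x|).
Proof.
move=> x1 ux; have /andP[x0 xu] := one_sub_gt0 x1 ux.
have u0 := lt_le_trans x0 xu.
have Hu : -`|x| <= u by rewrite lerNl (le_trans (ler_norm _)) ?normrN.
rewrite ler_norml opprK ler_ln ?posrE // xu /=.
rewrite -lnV ?posrE // ler_ln ?posrE ?invr_gt0 //.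
rewrite -[leRHS]mul1r ler_pdivlMr //.
have := normr_ge0 x; nra.
Qed.

(** The ratio of consecutive terms is [(n + 1 + s) / (n + 1) * x]; its absolute value tends to [|x|]
    and so is eventually at most [(1 + |x|) / 2]. *)
Lemma binomial_coef_cvg0 c s x :
  (forall k, k.+1%:R * c k.+1 = (k%:R + s) * c k) -> `|x| < 1 ->
  (fun N => N.+1%:R * c N.+1 * x ^+ N) @ \oo --> (0 : R).
Proof.
move=> cS x1; have r0 := normr_ge0 x.
(* Beyond [B] one has [|s| / (n + 1) <= (1 - |x|) / 2], and the ratio bound reduces to
   [(1 - |x|) ^ 2 >= 0]. *)
pose B := 2 * `|s| / (1 - `|x|).
have B0 : 0 <= B by rewrite divr_ge0 ?mulr_ge0 // subr_ge0 ltW.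
apply: (@ratio_cvg0 _ ((1 + `|x|) / 2) (Num.bound B)); first lra.
move=> n Hn; rewrite cS exprS !normrM mulrA.
have -> : `|n.+1%:R + s| * `|c n.+1| * `|x| * `|x ^+ n| =
  (`|n.+1%:R + s| * `|x|) * (`|c n.+1| * `|x ^+ n|) by ring.
have -> : (1 + `|x|) / 2 * (`|n.+1%:R| * `|c n.+1| * `|x ^+ n|) =
  (1 + `|x|) / 2 * `|n.+1%:R| * (`|c n.+1| * `|x ^+ n|) by ring.
apply: ler_wpM2r; first by rewrite mulr_ge0.
have Hb : 2 * `|s| <= n.+1%:R * (1 - `|x|).
  rewrite -ler_pdivrMr ?subr_gt0 //.
  apply: ltW; apply: (lt_le_trans (archi_boundP B0)).
  by rewrite ler_nat (leq_trans Hn).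
have Ha := ler_normD (n.+1%:R : R) s; rewrite normr_nat in Ha *.
have s0 := normr_ge0 s; nra.
Qed.

Lemma binomial_series c s x : c 0%N = 1 ->
  (forall k, k.+1%:R * c k.+1 = (k%:R + s) * c k) -> `|x| < 1 ->
  (fun N => \sum_(0 <= k < N) c k * x ^+ k) @ \oo --> (1 - x) `^ (- s).
Proof.
move=> c0 cS x1; pose p N : {poly R} := \sum_(0 <= k < N) c k *: 'X^k.
have pE N y : (p N).[y] = \sum_(0 <= k < N) c k * y ^+ k.
  by rewrite horner_sum; apply: eq_bigr => k _; rewrite hornerZ hornerXn.
(* Truncated form of the equation [(1 - u) * y' = s * y] satisfied by [(1 - u) ^ (- s)]; one
   boundary term remains. *)
have dpE N : (1 - 'X) * (p N.+1)^`() =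
    s *: p N.+1 - (N.+1%:R * c N.+1) *: 'X^N.
  elim: N => [|N IH].
    rewrite /p big_nat1 expr0 derivZ derivC scaler0 mulr0 cS add0r.
    by rewrite scalerA subrr.
  rewrite /p big_nat_recr //= -/(p _) derivD mulrDr IH derivZ derivXn /=.
  rewrite -scalerMnr scalerMnl -(mulr_natl (c N.+1)) (cS N.+1) scalerDr scalerA.
  rewrite [(_ + s) * _]mulrDl scalerDl exprS.
  set A := _ * c _; set B := s * c _.
  by rewrite mulrBl mul1r -scalerAr; ring.
(* [E u] is [(1 - u) ^ s], and [M] bounds [E u / (1 - u)] on the disc [|u| <= |x|]. *)
pose E u : R := expR (s * ln (1 - u)).
pose M : R := expR (`|s| * - ln (1 - `|x|)) / (1 - `|x|).
pose a N : R := N.+1%:R * c N.+1 * x ^+ N.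
have Hb N : `|(p N.+1).[x] * E x - 1| <= `|a N| * M * `|x|.
  have -> : 1 = (p N.+1).[0] * E 0.
    rewrite /E subr0 ln1 mulr0 expR0 mulr1 pE big_nat_recl // expr0 mulr1 c0.
    by rewrite big1 ?addr0 // => k _; rewrite exprS mul0r mulr0.
  apply: (norm_sub_le_deriv (f := fun y => (p N.+1).[y] * E y)
    (df := fun u => - (N.+1%:R * c N.+1 * u ^+ N) * (E u / (1 - u)))) => u Hu;
    have /andP[x0 xu] := one_sub_gt0 x1 Hu.
    have u1 : u < 1 by rewrite -subr_gt0 (lt_le_trans x0).
    have Hd := is_derive_ln_one_sub u1.
    apply: is_derive_eq; rewrite -/(E u).
    have u0 : 1 - u != 0 by rewrite subr_eq0 gt_eqF.
    have scE (y z : R) : y *: (z : R^o) = y * z by [].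
    have := congr1 (horner^~ u) (dpE N); rewrite !hornerE /= => dpu.
    have -> : (p N.+1)^`().[u] =
        (s * (p N.+1).[u] - N.+1%:R * c N.+1 * u ^+ N) / (1 - u).
      by rewrite -dpu; field.
    by rewrite !scE; field.
  rewrite mulNr normrN normrM; apply: ler_pM => //.
    rewrite /a !normrM !normrX; apply: ler_wpM2l; first by rewrite mulr_ge0.
    by rewrite lerXn2r ?nnegrE.
  have u0 := lt_le_trans x0 xu.
  rewrite normrM normfV (gtr0_norm u0) /M (ger0_norm (expR_ge0 _)).
  apply: ler_pM; rewrite ?expR_ge0 ?invr_ge0 ?(ltW u0) //; last first.
    by rewrite lef_pV2 ?posrE.
  rewrite ler_expR (le_trans (ler_norm _)) // normrM ler_wpM2l //.
  exact: norm_ln_one_sub_le.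
have /andP[x0 xx] := one_sub_gt0 x1 (lexx _).
have Ex : (1 - x) `^ (- s) = (E x)^-1.
  by rewrite powRN /powR gt_eqF // (lt_le_trans x0).
pose K := M * `|x| / E x.
apply: (cvg_dist_le (e := fun N => `|a N| * K)).
  move=> N; rewrite -pE Ex /K !mulrA ler_pdivlMr ?expR_gt0 //.
  rewrite -[X in _ * X](ger0_norm (expR_ge0 _)) -normrM mulrBl mulVf ?gt_eqF ?expR_gt0 //.
  by rewrite -!mulrA; have := Hb N; rewrite /M /E -!mulrA.
rewrite -[X in _ --> X](mul0r K); apply: cvgMr_tmp; rewrite -(@normr0 _ R); apply: cvg_norm.
exact: binomial_coef_cvg0 cS x1.
Qed.
End Series.

(** * Generating functions of the three families *)

Section GeneratingFunctions.
Variables (R : realType) (b : nat) (fam : bfamily R).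
Hypotheses (b_gt0 : (0 < b)%N) (Hfam : fam_ok fam).

Lemma phi_series t : phi_dom fam t ->
  (fun N : nat => \sum_(0 <= k < N) phiw b fam k * t ^+ k) @ \oo
    --> phi_gf b fam t.
Proof.
move: Hfam; rewrite /phi_dom /phi_gf /phiw; case: fam => [_ _|d d2 _|a a0 t1].
- set A : R := _%:R.
  rewrite (_ : (fun N => _) = (fun N => A * series (exp_coeff (b%:R * t)) N)); last first.
    apply/funext => N; rewrite /series /= mulr_sumr; apply: eq_bigr => k _.
    by rewrite /exp_coeff /= exprMn; ring.
  by apply: cvgMl_tmp; apply: is_cvg_series_exp_coeff.
(* Here the generating function is a polynomial, so the partial sums are eventually constant. *)
- set A : R := _ * gbinom _ _; apply: cvg_near_cst; near=> N.
  have HN : (b * d.-1 + 1 < N)%N by near: N; exact: nbhs_infty_gt.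
  under eq_bigr do rewrite -mulrA.
  rewrite -mulr_sumr exprDn big_mkord; congr (_ * _).
  rewrite -(big_mkord xpredT (fun i => 1 ^+ (b * d.-1 + 1 - i) * t ^+ i *+ 'C(b * d.-1 + 1, i))).
  rewrite -(big_mkord xpredT (fun i => 'C(b * d.-1 + 1, i)%:R * t ^+ i)).
  rewrite [LHS](@big_cat_nat _ _ _ (b * d.-1 + 1).+1) //=.
  rewrite [X in _ + X]big_nat_cond [X in _ + X]big1 ?addr0.
    by apply: eq_bigr => i _; rewrite expr1n mul1r mulr_natl.
  by move=> i /andP[/andP[Hi _] _]; rewrite bin_small ?mul0r.
- set A : R := _ * gbinom _ b.-1; rewrite -powRN.
  rewrite (_ : (fun N => _) = (fun N => A *
      \sum_(0 <= k < N) gbinom ((a + 1) * b%:R - 2 + k%:R) k * t ^+ k)); last first.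
    by apply/funext => N; rewrite mulr_sumr; apply: eq_bigr => k _; rewrite mulrA.
  (* The exponent is [(a + 1) * b - 1]: the shift in [gbinomS] adds one to [(a + 1) * b - 2]. *)
  apply: cvgMl_tmp; apply: binomial_series => //.
    by rewrite /gbinom big_ord0 divr1.
  by move=> k; rewrite gbinomS -(addn1 k) natrD; congr (_ * _); ring.
Unshelve. all: by end_near.
Qed.

Lemma T_series z : T_dom fam z ->
  (fun N : nat => \sum_(1 <= n < N) Ttot b fam n * z ^+ n / (n`!)%:R) @ \oo
    --> T_gf fam z.
Proof.
rewrite (_ : (fun N => _) = (fun N => \sum_(1 <= n < N)
    rising fam n * z ^+ n / (n`!)%:R)); last first.
  apply/funext => N; rewrite !big_nat; apply: eq_bigr => n /andP[n0 _].
  by rewrite Ttot_rising.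
have fact_neq0 n : (n`!)%:R != 0 :> R by rewrite pnatr_eq0 -lt0n fact_gt0.
(* A zero offset is the recursive case, with a logarithm; otherwise the series is
   [((1 - s * z) ^ (- g / s) - 1) / g]. *)
have [Efam|Hoff] := eqVneq (offset fam) 0.
  move: Hfam Efam; rewrite /T_dom /T_gf; case E: fam => [|d|a] _ /=; last 2 first.
  - by move/eqP; rewrite oner_eq0.
  - by move/eqP; rewrite oppr_eq0 oner_eq0.
  move=> _ z1; rewrite lnV; last by rewrite posrE subr_gt0 (le_lt_trans (ler_norm z)).
  rewrite (_ : (fun N => _) = (fun N => \sum_(1 <= k < N) z ^+ k / k%:R)).
    exact: log_series.
  apply/funext => N; rewrite !big_nat; apply: eq_bigr => -[|n] // _.
  rewrite -Tn_formulaE //= factS natrM.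
  by field; rewrite nat1r fact_neq0 pnatr_eq0.
have s0 := lt0r_neq0 (slope_gt0 Hfam); set s := slope fam in s0.
set g := offset fam in Hoff.
move=> zdom; have x1 : `|s * z| < 1.
  rewrite normrM gtr0_norm ?slope_gt0 // mulrC -ltr_pdivlMr ?slope_gt0 // mul1r.
  move: zdom Hoff; rewrite /T_dom /s /g /slope /offset.
  by case: fam => //; rewrite eqxx.
have -> : T_gf fam z = g^-1 * ((1 - s * z) `^ (- (g / s)) - 1).
  move: Hoff; rewrite /T_gf /s /g /slope /offset; case: fam => [|d|a].
  - by rewrite eqxx.
  - by rewrite invr1 !mul1r.
  - by rewrite invrN1 !mulN1r opprK opprB.
(* The value at 0 is set apart: [rising] starts its factors at [j = 1], and the missing factor for
   [j = 0] is [g], so the formula would give [g] instead of 1 there. *)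
pose c n := if n is 0%N then 1 else g * rising fam n / (s ^+ n * (n`!)%:R).
have Hc : (fun N => \sum_(0 <= k < N) c k * (s * z) ^+ k) @ \oo -->
    (1 - s * z) `^ (- (g / s)).
  apply: binomial_series => // -[|k].
    rewrite /c /rising big_geq // expr1 factS fact0 muln1; by field.
  rewrite /c risingS // -/s -/g factS natrM !exprS -!(addn1 k) !natrD; field.
  by rewrite s0 fact_neq0 expf_neq0 //= nat1r pnatr_eq0.
rewrite -cvg_shiftS /=.
rewrite (_ : (fun N => _) = (fun N => g^-1 *
    (\sum_(0 <= k < N.+1) c k * (s * z) ^+ k - 1))); last first.
  apply/funext => N; rewrite [in RHS]big_nat_recl //= mul1r expr0 addrC addKr.
  rewrite big_add1 mulr_sumr; apply: eq_bigr => k _ /=.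
  rewrite exprMn; field; by rewrite Hoff fact_neq0 expf_neq0.
apply: cvgMl_tmp; apply: cvgB; last exact: cvg_cst.
by move: Hc; rewrite -cvg_shiftS.
Qed.
End GeneratingFunctions.

Theorem mainTheorem1 (R : realType) (b : nat) (fam : bfamily R) :
  (1 <= b)%N -> fam_ok fam ->
  (* (A) attraction probabilities coincide *)
  (forall (n : nat) (T : btree) (v : seq nat),
      ibt b n T -> fweight b fam T != 0 -> is_node T v ->
      pT b fam T v = pgrowth fam T v)
  (* (A) consequently the laws of the random unordered trees coincide *)
  /\ (forall (n : nat) (T : btree), (1 <= n)%N -> ibt b n T ->
      growth_law b fam T = model_law b fam T)
  (* (B) generating function of the phi_k *)
  /\ (forall t : R, phi_dom fam t ->
      (fun N : nat => \sum_(0 <= k < N) phiw b fam k * t ^+ k) @ \oo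
        --> phi_gf b fam t)
  (* (B) exponential generating function T(z) *)
  /\ (forall z : R, T_dom fam z ->
      (fun N : nat => \sum_(1 <= n < N) Ttot b fam n * z ^+ n / (n`!)%:R) @ \oo
        --> T_gf fam z)
  (* (B) total weights *)
  /\ (forall n : nat, (1 <= n)%N -> Ttot b fam n = Tn_formula fam n).
Proof.
move=> b1 Hfam; split; first exact: pT_pgrowth.
split; first exact: growth_law_model.
split; first exact: phi_series.
split; first exact: T_series.
by move=> n n0; rewrite Ttot_rising // Tn_formulaE.
Qed.
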